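(* Let $P\in\mathbb Z[x_1^{\pm1},\dots,x_d^{\pm1}]^+$ be projectively faithful. Suppose $R_P$ is approximately divisible, and $\tau$ is a pure faithful trace of $R_P$. Then: (a) $\tau$ is an order unit good trace of $R_P$ if and only if $\tau=\tau_r$ where $r\in(\mathbb R^d)^{++}$ is really isolated. (b) $\tau_r$ is a good trace of $R_P$ if and only if $r$ is really isolated and for all $v\in\mathrm{Log}\,P$, $P(r)/r^v\in\mathbb Z[\{r^w/P(r)\}_{w\in\mathrm{Log}\,P}]$. (c) $\tau_r$ is a good trace of $R_P\otimes\mathbb Q$ if and only if $r$ is really isolated.
   Context: $\mathbb Z[x_i^{\pm1}]^+$ is the set of Laurent polynomials in $x_1,\dots,x_d$ with nonnegative integer coefficients (here $P\ne0$); $x^w=x_1^{w(1)}\cdots x_d^{w(d)}$ for $w\in\mathbb Z^d$; $\mathrm{Log}\,P$ is the (finite) set of $w\in\mathbb Z^d$ whose monomial $x^w$ has nonzero coefficient in $P$. $P$ is projectively faithful if $\mathrm{Log}\,P-\mathrm{Log}\,P$ generates $\mathbb Z^d$ as an abelian group. $R_P=\mathbb Z[\{x^w/P\}_{w\in\mathrm{Log}\,P}]$ is the subring of the field of rational functions, partially ordered by the cone generated additively and multiplicatively by $\{x^w/P:w\in\mathrm{Log}\,P\}$; it is a dimension group and an ordered ring with $1$ as order unit. $R_P\otimes\mathbb Q$ has the cone of nonnegative rational combinations of $R_P^+$. A trace is a nonzero positive group homomorphism to $\mathbb R$; normalized traces satisfy $\tau(1)=1$ and form the compact convex set $S(R_P,1)$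 (point-open topology); pure traces are its extreme points; $\tau$ is faithful if its kernel contains no nonzero positive element. $(\mathbb R^d)^{++}$ is the set of strictly positive $d$-tuples. For $r\in(\mathbb R^d)^{++}$, $\tau_r(g/P^k)=g(r)/P(r)^k$ (extended $\mathbb Q$-linearly to $R_P\otimes\mathbb Q$); it is known that the pure faithful traces of $R_P$ are exactly the $\tau_r$, with $r$ unique. $R_P$ is approximately divisible if its image under $g\mapsto\hat g$, $\hat g(\tau)=\tau(g)$, is norm-dense in the continuous affine real functions on $S(R_P,1)$. A trace $\tau$ of $G$ is good if for every $b\in G^+$ and $a'\in G$ with $0\le\tau(a')\le\tau(b)$ there is $a$ with $0\le a\le b$ and $\tau(a)=\tau(a')$; order unit good if this holds for all order units $b$ of $G$. For $r\in(\mathbb R^d)^{++}$ let $I(\{r\})$ be the ideal of $\mathbb Z[x_1,\dots,x_d]$ of polynomials vanishing at $r$ and $ZI(\{r\})\subset\mathbb C^d$ the common zero set of $I(\{r\})$; $r$ is really isolated if $ZI(\{r\})\cap(\mathbb R^d)^{++}=\{r\}$. *)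

(* Defs.v *)
From HB Require Import structures.
From mathcomp Require Import all_boot all_order all_algebra.
From mathcomp Require Import finmap.
From mathcomp Require Import boolp classical_sets functions reals topology normedtype.
From mathcomp Require Import complex.
(* The notations of mpoly are incompatible with those of mathcomp-analysis. *)
From mathcomp Require Import -(notations) mpoly.

Set Implicit Arguments.
Unset Strict Implicit.
Unset Printing Implicit Defensive.
Import Order.TTheory GRing.Theory Num.Theory.
Import numFieldNormedType.Exports.

Local Open Scope classical_set_scope.
Local Open Scope ring_scope.

Definition cle (G : zmodType) (C : set G) (g h : G) : Prop := C (h - g).

Definition order_unit (G : zmodType) (C : set G) (u : G) : Prop :=
  C u /\ forall g, exists n : nat, cle C (- (u *+ n)) g /\ cle C g (u *+ n).

Definition is_trace (R : realType) (G : zmodType) (C : set G) (tau : G -> R) :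
    Prop :=
  [/\ {morph tau : g h / g + h},
      (forall g, C g -> 0 <= tau g) &
      (exists g, tau g != 0)].

(* The type [{ptws G -> R}] carries the point-open topology. *)
Definition states (R : realType) (G : zmodType) (C : set G) (u : G) :
    set {ptws G -> R} :=
  [set tau | is_trace C tau /\ tau u = 1].

Definition mix (R : realType) (G : zmodType) (t : R) (s1 s2 : G -> R) : G -> R :=
  fun g => t * s1 g + (1 - t) * s2 g.

Definition pure_trace (R : realType) (G : zmodType) (C : set G) (u : G)
    (tau : G -> R) : Prop :=
  states C u tau /\
  forall (s1 s2 : G -> R) (t : R), states C u s1 -> states C u s2 ->
    0 < t < 1 -> tau = mix t s1 s2 -> s1 = tau /\ s2 = tau.

Definition faithful_trace (R : realType) (G : zmodType) (C : set G)
    (tau : G -> R) : Prop :=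
  is_trace C tau /\ forall g, C g -> tau g = 0 -> g = 0.

Definition good_at (R : realType) (G : zmodType) (C : set G) (tau : G -> R)
    (b : G) : Prop :=
  forall a', 0 <= tau a' <= tau b ->
    exists a, [/\ cle C 0 a, cle C a b & tau a = tau a'].

Definition good_trace (R : realType) (G : zmodType) (C : set G)
    (tau : G -> R) : Prop :=
  is_trace C tau /\ forall b, C b -> good_at C tau b.

Definition order_unit_good_trace (R : realType) (G : zmodType) (C : set G)
    (tau : G -> R) : Prop :=
  is_trace C tau /\ forall b, order_unit C b -> good_at C tau b.

Definition affine_on (R : realType) (G : zmodType) (S : set {ptws G -> R})
    (h : {ptws G -> R} -> R) : Prop :=
  forall (s1 s2 : {ptws G -> R}) (t : R), S s1 -> S s2 -> 0 <= t <= 1 ->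
    h (mix t s1 s2) = t * h s1 + (1 - t) * h s2.

Definition approximately_divisible (R : realType) (G : zmodType) (C : set G)
    (u : G) : Prop :=
  forall h : {ptws G -> R} -> R,
    {within states C u, continuous h} -> affine_on (states C u) h ->
    forall e : R, 0 < e ->
      exists g : G, forall tau : {ptws G -> R}, states C u tau ->
        `|h tau - tau g| <= e.

Definition generated_subgroup (V : zmodType) (A : set V) : set V :=
  smallest (fun S : set V => GRing.zmod_closed [in S]) A.

Definition generated_subring (F : fieldType) (A : set F) : set F :=
  smallest (fun S : set F => GRing.subring_closed [in S]) A.

Definition generated_cone (F : fieldType) (A : set F) : set F :=
  smallest (fun S : set F =>
    GRing.addr_closed [in S] /\ GRing.mulr_2closed [in S]) A.

Definition rat_span (F : fieldType) (A : set F) : set F :=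
  smallest (fun S : set F => GRing.zmod_closed [in S] /\
    forall (q : rat) f, S f -> S (ratr q * f)) A.

Definition nonneg_rat_span (F : fieldType) (A : set F) : set F :=
  smallest (fun S : set F => GRing.addr_closed [in S] /\
    forall (q : rat) f, 0 <= q -> S f -> S (ratr q * f)) A.

(* The value at [w] is the coefficient of [x^w]. *)
Definition laurent (d : nat) := {fsfun {ffun 'I_d -> int} -> int with 0}.

Definition Log (d : nat) (P : laurent d) : set {ffun 'I_d -> int} :=
  [set w | P w != 0].

Definition monom (d : nat) (F : fieldType) (x : 'I_d -> F)
    (w : {ffun 'I_d -> int}) : F :=
  \prod_i x i ^ w i.

Definition leval (d : nat) (F : fieldType) (x : 'I_d -> F) (P : laurent d) : F :=
  \sum_(w <- finsupp P) (P w)%:~R * monom x w.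

Definition nonneg_laurent (d : nat) (P : laurent d) : Prop :=
  (forall w, 0 <= P w) /\ Log P !=set0.

Definition projectively_faithful (d : nat) (P : laurent d) : Prop :=
  generated_subgroup [set v - w | v in Log P & w in Log P] = setT.

(* [{x^w / P(x) : w in Log P}], used both for the indeterminates and for a point
   of [R^d]. *)
Definition ratios (d : nat) (F : fieldType) (x : 'I_d -> F) (P : laurent d) :
    set F :=
  [set monom x w / leval x P | w in Log P].

Notation ratfun d := {fraction (mpoly d int)}.

Definition indet (d : nat) (i : 'I_d) : ratfun d := tofrac (mpolyX int (mnm1 i)).

Definition RP_pred (d : nat) (P : laurent d) : {pred ratfun d} :=
  [in generated_subring (ratios (@indet d) P)].

Lemma RP_subring_closed (d : nat) (P : laurent d) :
  GRing.subring_closed (RP_pred P).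
Proof.
split; rewrite /RP_pred.
- by rewrite inE => S [[S1 _ _] _]; have := S1; rewrite inE.
- move=> f g; rewrite !inE => Hf Hg S HS; have [[_ SB _] _] := HS.
  by have := SB f g; rewrite !inE; apply; [exact: Hf|exact: Hg].
- move=> f g; rewrite !inE => Hf Hg S HS; have [[_ _ SM] _] := HS.
  by have := SM f g; rewrite !inE; apply; [exact: Hf|exact: Hg].
Qed.

HB.instance Definition _ (d : nat) (P : laurent d) :=
  GRing.isSubringClosed.Build (ratfun d) (RP_pred P) (RP_subring_closed P).

Record RP (d : nat) (P : laurent d) :=
  MkRP { RP_val :> ratfun d ; RP_valP : RP_val \in RP_pred P }.

HB.instance Definition _ (d : nat) (P : laurent d) :=
  [isSub for @RP_val d P].
HB.instance Definition _ (d : nat) (P : laurent d) :=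
  [Choice of RP P by <:].
HB.instance Definition _ (d : nat) (P : laurent d) :=
  [SubChoice_isSubComNzRing of RP P by <:].

Definition RP_pos (d : nat) (P : laurent d) : set (RP P) :=
  [set g | generated_cone (ratios (@indet d) P) (RP_val g)].

(* [R_P] is torsion-free, so [R_P (x) Q] is identified with the [Q]-linear span
   of [R_P] in the field of rational functions. *)
Definition RPQ_pred (d : nat) (P : laurent d) : {pred ratfun d} :=
  [in rat_span [set f | f \in RP_pred P]].

Lemma RPQ_zmod_closed (d : nat) (P : laurent d) :
  GRing.zmod_closed (RPQ_pred P).
Proof.
split; rewrite /RPQ_pred.
- by rewrite inE => S [[[S0 _] _] _]; have := S0; rewrite inE.
- move=> f g; rewrite !inE => Hf Hg S HS; have [[[_ SB] _] _] := HS.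
  by have := SB f g; rewrite !inE; apply; [exact: Hf|exact: Hg].
Qed.

HB.instance Definition _ (d : nat) (P : laurent d) :=
  GRing.isZmodClosed.Build (ratfun d) (RPQ_pred P) (RPQ_zmod_closed P).

Record RPQ (d : nat) (P : laurent d) :=
  MkRPQ { RPQ_val :> ratfun d ; RPQ_valP : RPQ_val \in RPQ_pred P }.

HB.instance Definition _ (d : nat) (P : laurent d) :=
  [isSub for @RPQ_val d P].
HB.instance Definition _ (d : nat) (P : laurent d) :=
  [Choice of RPQ P by <:].
HB.instance Definition _ (d : nat) (P : laurent d) :=
  [SubChoice_isSubZmodule of RPQ P by <:].

Definition RPQ_pos (d : nat) (P : laurent d) : set (RPQ P) :=
  [set g | nonneg_rat_span [set RP_val h | h in RP_pos (P := P)] (RPQ_val g)].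

Definition positive_point (R : realType) (d : nat) : set ('I_d -> R) :=
  [set r | forall i, 0 < r i].

(* Every element of [R_P] is of the form [g / P^k]; for a positive point [r] the
   value [g(r) / P(r)^k] does not depend on this representation, so [xget]
   selects the only element of the set. *)
Definition tau_pt (R : realType) (d : nat) (P : laurent d) (r : 'I_d -> R) :
    RP P -> R :=
  fun f => xget 0 [set t | exists (g : laurent d) (k : nat),
    RP_val f = leval (@indet d) g / leval (@indet d) P ^+ k /\
    t = leval r g / leval r P ^+ k].

(* By clearing denominators, every element of the rational span of [R_P] is
   [q * h] with [q] rational and [h] in [R_P]. *)
Definition tau_ptQ (R : realType) (d : nat) (P : laurent d) (r : 'I_d -> R) :
    RPQ P -> R :=
  fun f => xget 0 [set t | exists (q : rat) (h : RP P),
    RPQ_val f = ratr q * RP_val h /\ t = ratr q * tau_pt r h].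

Definition vanishing_ideal (R : realType) (d : nat) (r : 'I_d -> R) :
    set (mpoly d int) :=
  [set p | mmap intr r p = 0].

Definition zero_locus (R : realType) (d : nat) (r : 'I_d -> R) :
    set ('I_d -> complex R) :=
  [set z | forall p, vanishing_ideal r p -> mmap intr z p = 0].

Definition complex_point (R : realType) (d : nat) (r : 'I_d -> R) :
    'I_d -> complex R :=
  fun i => real_complex R (r i).

Definition really_isolated (R : realType) (d : nat) (r : 'I_d -> R) : Prop :=
  zero_locus r `&` (@complex_point R d @` @positive_point R d)
  = [set complex_point r].

(* Main.v *)
Require Import Defs.
From HB Require Import structures.
From mathcomp Require Import all_boot all_order all_algebra.
From mathcomp Require Import finmap.
From mathcomp Require Import boolp classical_sets functions reals topology normedtype.
From mathcomp Require Import complex.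
From mathcomp Require Import -(notations) mpoly.
From mathcomp Require Import zify ring lra.

(* Write tau = tau_r and J = ker tau.  If I({r}) also vanishes at a positive
   r' <> r, then J lies in the kernel of tau_r', and approximate divisibility
   gives an a' whose value at r is in [0, 1] and whose value at r' is negative:
   no element of a' + J is positive.

   Conversely let r be really isolated.  Algebraic points s with I({r})
   vanishing at s accumulate at r (specialize the coordinates one after the
   other), so r is algebraic.  Hence every positive ring homomorphism killing J
   is tau: it cannot kill x^w/P, whose value at r is algebraic and nonzero, so
   it is an evaluation at a positive point.  By the Kadison-Dubois theorem for
   the cone R_P^+ + J, an element with positive value at r is, up to a multiple,
   in R_P^+ + J; this yields F >= 0 in J such that a' and b - a' are positive
   where F is small, and then a' + F h lies strictly between 0 and b for a
   suitable h.  Strict positivity under all positive homomorphisms implies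
   positivity, again by Kadison-Dubois.

   Goodness at products of the x^w/P reduces to goodness at 1 as soon as the
   values of these elements are invertible in the range of tau, and
   [0, x^v/P] consists of multiples of x^v/P. *)

Set Implicit Arguments.
Unset Strict Implicit.
Unset Printing Implicit Defensive.
Import Order.TTheory GRing.Theory Num.Theory.
Import numFieldNormedType.Exports.

Local Open Scope classical_set_scope.
Local Open Scope ring_scope.

(** * The Kadison-Dubois theorem *)

(** Positivity in [R_P] is tested on positive ring homomorphisms to [R] only. Those that are not
    evaluations at positive points live on faces of the Newton polytope, and real isolation by
    itself says nothing about them; this is why the algebraicity of [r] has to be established.

    Approximate divisibility produces elements with prescribed values up to an error, whereas
    goodness asks for an exact value at [r]. Multiplying the approximation by [F] in the kernel
    makes the error invisible at [r] and keeps it small elsewhere. The interpolating weight must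
    therefore differ from [1] by a multiple of [F], which powers of [1 - F/M] do, and such powers
    can be made small wherever [F] is bounded away from [0].

    The integer multiple left by Kadison-Dubois disappears because, over a common denominator,
    positivity in [R_P] is a condition on integer coefficients. *)

Lemma le0_of_natmul_bounded (R : archiRealFieldType) (x c : R) :
  (forall q : nat, (0 < q)%N -> x *+ q <= c) -> x <= 0.
Proof.
move=> H; case: (lerP x 0) => // x0.
have [n Hn] : exists n : nat, c / x < n%:R.
  exists (Num.bound `|c / x|); apply: le_lt_trans (ler_norm _) _.
  by apply: archi_boundP; exact: normr_ge0.
have := H n.+1 isT; rewrite -mulr_natl => H1.
move: Hn; rewrite ltr_pdivrMr // => Hn.
have : (n%:R : R) * x < n.+1%:R * x by rewrite ltr_pM2r // ltr_nat.
by move=> H2; have := lt_le_trans (lt_trans Hn H2) H1; rewrite ltxx.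
Qed.

(** The archimedean semirings of real algebra. Squares need not belong to [C]: the cone of [R_P]
    misses those of nonzero elements vanishing at a positive point. *)
Record semicone (A : comNzRingType) (C : set A) : Prop := Semicone {
  semicone_add : forall x y, C x -> C y -> C (x + y);
  semicone_mul : forall x y, C x -> C y -> C (x * y);
  semicone_nat : forall n : nat, C n%:R;
  semicone_arch : forall x, exists n : nat, C (n%:R - x) }.

Lemma semicone_natmul (A : comNzRingType) (C : set A) x n :
  semicone C -> C x -> C (x *+ n).
Proof. by move=> [_ CM Cn _] Cx; rewrite -mulr_natr; apply: CM. Qed.

(** Both signs of a kernel element lie in this cone, so its positive homomorphisms are those of [C]
    that kill [ker phi]. *)
Lemma semicone_add_kernel (A B : comNzRingType) (C : set A)
    (phi : {rmorphism A -> B}) : semicone C ->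
  semicone [set x | exists c j, [/\ C c, phi j = 0 & x = c + j]].
Proof.
case=> CD CM Cn Ca.
have sub x : C x -> exists c j, [/\ C c, phi j = 0 & x = c + j].
  by move=> Cx; exists x, 0; rewrite rmorph0 addr0.
split.
- move=> _ _ [c [j [Cc j0 ->]]] [c' [j' [Cc' j'0 ->]]].
  exists (c + c'), (j + j'); split; [exact: CD|by rewrite rmorphD j0 j'0 addr0|ring].
- move=> _ _ [c [j [Cc j0 ->]]] [c' [j' [Cc' j'0 ->]]].
  exists (c * c'), (c * j' + j * c' + j * j'); split; [exact: CM| |ring].
  by rewrite !rmorphD !rmorphM j0 j'0 !(mulr0, mul0r) !addr0.
- by move=> n; exact/sub/Cn.
- by move=> a; have [n Hn] := Ca a; exists n; exact: sub.
Qed.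

Section KadisonDubois.
Variables (R : realType) (A : comNzRingType) (C : set A).
Hypothesis Ccone : semicone C.

Let CD := semicone_add Ccone.
Let CM := semicone_mul Ccone.
Let Cn := semicone_nat Ccone.
Let Ca := semicone_arch Ccone.

(** Zorn's lemma is applied to [C]-modules instead of semirings because the extension by [f] is just
    [M + C f], of degree one in [f]. *)
Definition proper_module (M : set A) : Prop :=
  [/\ C `<=` M, forall x y, M x -> M y -> M (x + y),
      forall c x, C c -> M x -> M (c * x) & ~ M (-1)].

Section Maximal.
Variable M : set A.
Hypothesis M_proper : proper_module M.
Hypothesis M_max : forall M', M `<=` M' -> proper_module M' -> M' `<=` M.

Let MC : C `<=` M. Proof. by case: M_proper. Qed.
Let MD : forall x y, M x -> M y -> M (x + y). Proof. by case: M_proper. Qed.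
Let MM : forall c x, C c -> M x -> M (c * x). Proof. by case: M_proper. Qed.
Let M1 : ~ M (-1). Proof. by case: M_proper. Qed.

Lemma maximal_module_extend f : ~ M f ->
  exists m c, [/\ M m, C c & -1 = m + c * f].
Proof.
move=> nf; apply: contrapT => H.
pose M' := [set x | exists m c, [/\ M m, C c & x = m + c * f]].
have := @M_max M' _ _.
move=> H'; apply: nf; apply: H' => //.
- by move=> x Mx; exists x, 0; split => //; [exact: (Cn 0)|rewrite mul0r addr0].
- split.
  + by move=> x Cx; exists x, 0; split => //; [exact: MC|exact: (Cn 0)|rewrite mul0r addr0].
  + move=> _ _ [m [c [Mm Cc ->]]] [m' [c' [Mm' Cc' ->]]].
    exists (m + m'), (c + c'); split; [exact: MD|exact: CD|by rewrite mulrDl addrACA].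
  + move=> a _ Ca' [m [c [Mm Cc ->]]].
    exists (a * m), (a * c); split; [exact: MM|exact: CM|by rewrite mulrDr mulrA].
  + by move=> [m [c [Mm Cc E]]]; apply: H; exists m, c.
- by exists 0, 1; split; [exact: (MC (Cn 0))|exact: (Cn 1)|rewrite add0r mul1r].
Qed.

Lemma maximal_module_total f : M f \/ M (- f).
Proof.
case: (pselect (M f)) => [|nf]; [by left|right].
apply: contrapT => nf'.
have [m [c [Mm Cc E]]] := maximal_module_extend nf.
have [m' [c' [Mm' Cc' E']]] := maximal_module_extend nf'.
apply: M1.
(* Eliminating [f] between the two expressions of [-1] leaves [- c]. *)
have Mc : M (- c).
  have -> : - c = c' + (c * m' + c' * m).
    have -> : c * m' = c * (-1 - c' * - f) by rewrite E' addrK.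
    have -> : c' * m = c' * (-1 - c * f) by rewrite E addrK.
    by ring.
  by apply: MD; [exact: MC|apply: MD; apply: MM].
(* As [n + f] is in [C], the element [c f = c (n + f) + n (- c)] is in [M], and then so is
   [-1 = m + c f]. *)
have [n Hn] := Ca (- f).
have : M (c * f).
  have -> : c * f = c * (n%:R - - f) + n%:R * (- c) by ring.
  by apply: MD; [apply: MC; apply: CM|apply: MM].
by move=> H; rewrite E; apply: MD.
Qed.

Lemma proper_module_nat (n : int) : M n%:~R -> 0 <= n.
Proof.
case: n => // n H; case: M1.
have -> : -1 = (Negz n)%:~R + n%:R :> A.
  by rewrite NegzE mulrNz -pmulrn -natr1; ring.
by apply: MD => //; apply: MC.
Qed.

(** The Dedekind cut of [x] in the preorder given by [M], with order unit [1]. Denominators are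
    cleared because [A] need not contain the rationals. *)
Definition module_state (x : A) : R :=
  sup [set t : R | exists (p : int) (q : nat),
    [/\ (0 < q)%N, M (x *+ q - p%:~R) & t = p%:~R / q%:R]].

Lemma module_state_has_sup x : has_sup [set t : R | exists (p : int) (q : nat),
    [/\ (0 < q)%N, M (x *+ q - p%:~R) & t = p%:~R / q%:R]].
Proof.
split.
  have [n Hn] := Ca (- x); exists ((- n%:Z)%:~R / 1%:R), (- n%:Z), 1%N; split => //.
  rewrite mulr1n mulrNz opprK addrC -pmulrn.
  by apply: MC; rewrite opprK in Hn.
have [n Hn] := Ca x; exists n%:R => _ [p [q [q0 Mp ->]]].
rewrite ler_pdivrMr ?ltr0n // -natrM.
have H : M ((n * q)%N%:Z - p)%:~R.
  have -> : ((n * q)%N%:Z - p)%:~R = q%:R * (n%:R - x) + (x *+ q - p%:~R) :> A.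
    by rewrite intrD mulrNz -pmulrn natrM -(mulr_natl x); ring.
  by apply: MD => //; apply: MC; apply: CM.
by have := proper_module_nat H; rewrite subr_ge0 -(ler_int R) -pmulrn.
Qed.

Lemma module_state_ge x (p : int) (q : nat) : (0 < q)%N ->
  M (x *+ q - p%:~R) -> p%:~R <= module_state x *+ q.
Proof.
move=> q0 H; rewrite -mulr_natr -ler_pdivrMr ?ltr0n //.
by apply: sup_upper_bound; [exact: module_state_has_sup|exists p, q].
Qed.

Lemma module_state_le x (p : int) (q : nat) : (0 < q)%N ->
  M (p%:~R - x *+ q) -> module_state x *+ q <= p%:~R.
Proof.
move=> q0 H; rewrite -mulr_natr -ler_pdivlMr ?ltr0n //.
apply: sup_le_ub; first by case: (module_state_has_sup x).
move=> _ [p' [q' [q'0 Mp ->]]].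
rewrite ler_pdivrMr ?ltr0n // mulrAC ler_pdivlMr ?ltr0n //.
have : M (p * q'%:Z - p' * q%:Z)%:~R.
  have -> : (p * q'%:Z - p' * q%:Z)%:~R =
      q'%:R * (p%:~R - x *+ q) + q%:R * (x *+ q' - p'%:~R) :> A.
    rewrite intrD mulrNz !intrM -!pmulrn -!(mulr_natl x); ring.
  by apply: MD; apply: MM.
by move/proper_module_nat; rewrite subr_ge0 -(ler_int R) !intrM -!pmulrn.
Qed.

(* Approximating by floors with a common denominator [q] costs [2 / q]. *)
Lemma module_state_floor x (q : nat) : (0 < q)%N ->
  exists p : int, [/\ M (x *+ q - p%:~R), M ((p + 2)%:~R - x *+ q),
    p%:~R <= module_state x *+ q & module_state x *+ q <= (p + 2)%:~R].
Proof.
move=> q0; pose p := Num.floor (module_state x *+ q).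
have pl : p%:~R <= module_state x *+ q by rewrite /p; exact: floor_le.
have pr : module_state x *+ q < (p + 1)%:~R by rewrite /p; exact: floorD1_gt.
exists (p - 1); split.
- case: (maximal_module_total (x *+ q - (p - 1)%:~R)) => // /=.
  rewrite opprB => /(module_state_le q0) H.
  by have := le_trans pl H; rewrite ler_int lerDl.
- case: (maximal_module_total (x *+ q - (p + 1)%:~R)) => /=.
    by move/(module_state_ge q0) => H; have := le_lt_trans H pr; rewrite ltxx.
  by rewrite opprB -addrA.
- by apply: le_trans pl; rewrite ler_int; lia.
- by apply: le_trans (ltW pr) _; rewrite ler_int; lia.
Qed.

(** The bracketing by floors bounds [q] times the difference by [2 psi 1] for every [q]. Uniqueness
    is what makes the state multiplicative. *)
Lemma module_state_unique (psi : A -> R) :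
  {morph psi : x y / x + y} -> (forall x, M x -> 0 <= psi x) ->
  forall x, psi x = psi 1 * module_state x.
Proof.
move=> psiD psi0.
have psi00 : psi 0 = 0.
  by apply: (addrI (psi 0)); rewrite -psiD !addr0.
have psiN x : psi (- x) = - psi x.
  by apply: (addrI (psi x)); rewrite -psiD !subrr.
have psin x n : psi (x *+ n) = psi x *+ n.
  by elim: n => [|n IH]; rewrite ?mulr0n // !mulrS psiD IH.
have psiz (n : int) : psi n%:~R = psi 1 * n%:~R.
  case: n => n; first by rewrite -!pmulrn psin mulr_natr.
  by rewrite !NegzE !mulrNz psiN -!pmulrn psin -mulr_natr mulrN.
have p1 : 0 <= psi 1 by apply: psi0; apply: MC; exact: (Cn 1).
move=> x; apply/eqP; rewrite -subr_eq0 -normr_eq0 eq_le normr_ge0 andbT.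
apply: (@le0_of_natmul_bounded _ _ (psi 1 * 2)) => q q0.
have [p [Mp Mp' lep lep']] := module_state_floor x q0.
have := psi0 _ Mp; rewrite psiD psiN psin psiz => H1.
have := psi0 _ Mp'; rewrite psiD psiN psin psiz => H2.
rewrite -normrMn mulrnBl ler_norml.
have : psi 1 * p%:~R <= psi 1 * (module_state x *+ q) by apply: ler_wpM2l.
have : psi 1 * (module_state x *+ q) <= psi 1 * (p + 2)%:~R by apply: ler_wpM2l.
move: H2; rewrite intrD -!mulrnAr; set s := module_state x *+ q.
by move=> *; apply/andP; split; lra.
Qed.

Lemma module_state_rmorphism :
  exists phi : {rmorphism A -> R}, forall x, M x -> 0 <= phi x.
Proof.
have phiD : {morph module_state : x y / x + y}.
  move=> x y; apply/eqP; rewrite -subr_eq0 -normr_eq0 eq_le normr_ge0 andbT.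
  apply: (@le0_of_natmul_bounded _ _ 4) => q q0.
  have [p [Mp Mp' lep lep']] := module_state_floor x q0.
  have [r [Mr Mr' ler ler']] := module_state_floor y q0.
  have H1 : (p + r)%:~R <= module_state (x + y) *+ q.
    apply: module_state_ge => //.
    have -> : (x + y) *+ q - (p + r)%:~R = (x *+ q - p%:~R) + (y *+ q - r%:~R).
      by rewrite intrD mulrnDl; ring.
    exact: MD.
  have H2 : module_state (x + y) *+ q <= (p + 2 + (r + 2))%:~R.
    apply: module_state_le => //.
    have -> : (p + 2 + (r + 2))%:~R - (x + y) *+ q = ((p + 2)%:~R - x *+ q) + ((r + 2)%:~R - y *+ q).
      by rewrite mulrnDl !intrD; ring.
    exact: MD.
  rewrite -normrMn mulrnBl mulrnDl ler_norml.
  move: H1 H2 lep lep' ler ler'; rewrite !intrD.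
  by move=> *; apply/andP; split; lra.
have phi0 x : M x -> 0 <= module_state x.
  by move=> Mx; have := @module_state_ge x 0 1 isT; rewrite subr0 !mulr1n; apply.
have phi1 : module_state 1 = 1.
  apply/eqP; rewrite eq_le; apply/andP; split.
    have := @module_state_le 1 1 1 isT; rewrite !mulr1n subrr; apply; exact: (MC (Cn 0)).
  have := @module_state_ge 1 1 1 isT; rewrite !mulr1n subrr; apply; exact: (MC (Cn 0)).
have phiB : zmod_morphism module_state.
  move=> x y; apply/eqP; rewrite eq_sym subr_eq; apply/eqP.
  by rewrite -phiD subrK.
have phiM : monoid_morphism module_state.
  split => // x y.
  (* For [c] in [C], multiplication by [c] preserves the module, so [z |-> module_state (c z)] is
     nonnegative on it and hence a multiple of the state. A general factor is a difference
     [n - (n - x)] of elements of [C]. *)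
  have phiCM c z : C c -> module_state (c * z) = module_state c * module_state z.
    move=> Cc; rewrite -{2}(mulr1 c).
    apply: (module_state_unique (psi := fun z => module_state (c * z))).
      by move=> u v /=; rewrite mulrDr phiD.
    by move=> u Mu; apply: phi0; apply: MM.
  have [n Hn] := Ca x.
  have -> : x * y = n%:R * y - (n%:R - x) * y by ring.
  have Ex : module_state x = module_state n%:R - module_state (n%:R - x).
    by rewrite phiB opprB addrC subrK.
  rewrite phiB phiCM // phiCM // Ex; ring.
pose phi : {rmorphism A -> R} := HB.pack module_state
  (GRing.isZmodMorphism.Build _ _ module_state phiB)
  (GRing.isMonoidMorphism.Build _ _ module_state phiM).
by exists phi.
Qed.

End Maximal.

Lemma proper_module_rmorphism M : proper_module M ->
  exists phi : {rmorphism A -> R}, forall x, M x -> 0 <= phi x.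
Proof.
move=> pM.
pose Q := [set X : set A | X = set0 \/ M `<=` X /\ proper_module X].
have [F FQ Ftot|N [QN Nmax]] := @Zorn_bigcup A Q.
  case: (pselect (exists2 X, F X & X != set0)) => [[X0 FX0 nX0]|H]; last first.
    left; rewrite -subset0 => x [X FX Xx]; apply: H; exists X => //.
    by apply/set0P; exists x.
  right; have good X x : F X -> X x -> M `<=` X /\ proper_module X.
    by move=> FX Xx; case: (FQ _ FX) => // X_0; rewrite X_0 in Xx.
  have [x0 Xx0] : X0 !=set0 by apply/set0P.
  have [MX0 [CX0 _ _ _]] := good _ _ FX0 Xx0.
  split; first by move=> x Mx; exists X0 => //; apply: MX0.
  split.
  - by move=> x Cx; exists X0 => //; apply: CX0.
  - move=> x y [X FX Xx] [Y FY Yy].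
    have [_ [_ XD _ _]] := good _ _ FX Xx; have [_ [_ YD _ _]] := good _ _ FY Yy.
    case: (Ftot _ _ FX FY) => sXY; first by exists Y => //; apply: YD => //; apply: sXY.
    by exists X => //; apply: XD => //; apply: sXY.
  - move=> c x Cc [X FX Xx]; have [_ [_ _ XM _]] := good _ _ FX Xx.
    by exists X => //; apply: XM.
  - by move=> [X FX X1]; have [_ [_ _ _ /(_ X1)]] := good _ _ FX X1.
have [MN pN] : M `<=` N /\ proper_module N.
  case: QN => // N0; exfalso; apply: (Nmax M); last by right; split.
  split; rewrite N0; first exact: sub0set.
  by move=> H; have [CM' _ _ _] := pM; exact: (H 1 (CM' _ (Cn 1))).
have [M' NM' pM' x M'x|phi Hphi] := @module_state_rmorphism N pN.
  apply: contrapT => nx; apply: (Nmax M'); last first.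
    by right; split => //; exact: subset_trans MN NM'.
  by split => // H; apply: nx; apply: H.
by exists phi => x Mx; apply: Hphi; apply: MN.
Qed.

Lemma kadison_dubois (a : A) :
  (forall phi : {rmorphism A -> R}, (forall x, C x -> 0 <= phi x) -> 0 < phi a) ->
  exists N : nat, (0 < N)%N /\ C (a *+ N).
Proof.
move=> apos.
(* If [C - a C] missed [-1], some homomorphism nonnegative on it would have [phi a <= 0]. *)
pose M := [set x | exists c c', [/\ C c, C c' & x = c - a * c']].
have [c [c' [Cc Cc' E]]] : M (-1).
  apply: contrapT => M1.
  have [|phi Hphi] := @proper_module_rmorphism M.
    split => //.
    - by move=> x Cx; exists x, 0; split => //; [exact: (Cn 0)|rewrite mulr0 subr0].
    - move=> _ _ [c [c' [Cc Cc' ->]]] [e [e' [Ce Ce' ->]]].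
      by exists (c + e), (c' + e'); split; [exact: CD|exact: CD|ring].
    - move=> b _ Cb [c [c' [Cc Cc' ->]]].
      by exists (b * c), (b * c'); split; [exact: CM|exact: CM|ring].
  have := apos phi; rewrite ltNge; move=> H.
  have : ~~ (phi a <= 0).
    apply: H => x Cx; apply: Hphi; exists x, 0.
    by split => //; [exact: (Cn 0)|rewrite mulr0 subr0].
  rewrite -oppr_ge0 -rmorphN Hphi //.
  by exists 0, 1; split; [exact: (Cn 0)|exact: (Cn 1)|rewrite mulr1 sub0r].
have E1 : a * c' = 1 + c by rewrite -(opprK 1) E; ring.
have [n Cnc] := Ca c'.
have [k Ck] := Ca (- a).
have n0 : (0 < n.+1)%N by [].
have Cnc' : C (n.+1%:R - c').
  by rewrite -natr1 addrAC; apply: CD => //; exact: (Cn 1).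
have : exists N : nat, (0 < N)%N /\ C ((a *+ n.+1 + (k * n.+1)%:R) *+ N).
  exists 1%N; split => //; rewrite mulr1n.
  have -> : a *+ n.+1 + (k * n.+1)%:R = (k%:R - - a) * n.+1%:R.
    by rewrite natrM -(mulr_natr a); ring.
  exact: CM.
(* Descent from [a + k], which is in [C], to [a] in steps of [1 / n.+1]; the multiple [N] absorbs
   the denominators. *)
elim: (k * n.+1)%N => [|j IH] [N [N0 CN]].
  exists (n.+1 * N)%N; split; first by rewrite muln_gt0.
  by rewrite addr0 in CN; rewrite mulrnA.
(* [n(a+k/n) = (n-c')(a+k/n) + c'a + c'k/n] and [c'a = 1 + c] *)
apply: IH; exists (n.+1 * N)%N; split; first by rewrite muln_gt0.
have -> : (a *+ n.+1 + j%:R) *+ (n.+1 * N) =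
  (n.+1%:R - c') * ((a *+ n.+1 + j.+1%:R) *+ N) + ((N * n.+1)%:R * c + N%:R * (j.+1%:R * c')).
  rewrite -(mulr_natr (a *+ n.+1 + j%:R)) -(mulr_natr (a *+ n.+1 + j.+1%:R)).
  rewrite -(mulr_natr a) !natrM -(natr1 j).
  have -> : c = a * c' - 1 by rewrite E1; ring.
  ring.
by apply: CD; [exact: CM|apply: CD; apply: CM => //; apply: CM].
Qed.

End KadisonDubois.

(** * Algebraic points near a real point *)

(** At a simple root [f] changes sign; the change survives small moves of the coefficients, and the
    intermediate value theorem gives the new root. *)
Lemma root_perturb_pos (R : realType) (f : {poly R}) (u e : R) :
  f.[u] = 0 -> 0 < f^`().[u] -> 0 < e ->
  exists2 del : R, 0 < del & forall g : {poly R}, (size g <= size f)%N ->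
    (forall j, `|g`_j - f`_j| < del) -> exists2 u', `|u' - u| <= e & g.[u'] = 0.
Proof.
move=> /eqP/factor_theorem[q Df] f'u e0.
have qu : 0 < q.[u].
  by move: f'u; rewrite Df derivM derivXsubC !hornerE subrr mulr0 add0r.
have [s Ds] : exists s : {poly R}, q = q.[u]%:P + s * ('X - u%:P).
  have /factor_theorem[s Ds] : root (q - q.[u]%:P) u by rewrite rootE !hornerE subrr.
  by exists s; rewrite -Ds addrC subrK.
have [b ub] := poly_disk_bound s (`|u| + 1).
have b0 : 0 <= b.
  by apply: le_trans (ub u _); rewrite ?normr_ge0 // lerDl.
(* The quotient [q] of [f] by [X - u] has the value [f'(u)] at [u], and [b] bounds its slope nearby;
   the last bound on [h] keeps [q] positive on [[u - h, u + h]]. *)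
pose h := Num.min (Num.min e 1) (q.[u] / (b + 1) / 2).
have b1 : 0 < b + 1 by rewrite ltr_wpDl.
have h0 : 0 < h.
  by rewrite /h !lt_min e0 ltr01 /= divr_gt0 // divr_gt0.
have he : h <= e by rewrite /h !ge_min lexx.
have h1 : h <= 1 by rewrite /h !ge_min lexx orbT.
have hq : h * (b + 1) <= q.[u] / 2.
  by rewrite -ler_pdivlMr // mulrAC /h ge_min lexx orbT.
have qpos x : `|x - u| <= h -> 0 < q.[x].
  move=> xu; rewrite Ds !hornerE.
  have : `|s.[x] * (x - u)| <= b * h.
    rewrite normrM; apply: ler_pM => //; apply: ub.
    have -> : x = u + (x - u) by rewrite addrC subrK.
    by apply: le_trans (ler_normD _ _) _; rewrite lerD2l (le_trans xu).
  rewrite ler_norml => /andP[H _].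
  have : b * h + h <= q.[u] / 2 by move: hq; rewrite mulrDr mulr1 (mulrC h).
  move: H h0 qu; set t := s.[x] * _; set w := b * h => *; lra.
have fp : 0 < f.[u + h].
  rewrite Df !hornerE [u + h]addrC addrK mulr_gt0 // addrC qpos //.
  by rewrite addrAC subrr add0r gtr0_norm.
have fm : f.[u - h] < 0.
  rewrite Df !hornerE [u - h - u]addrAC subrr add0r mulrN oppr_lt0 mulr_gt0 // qpos //.
  by rewrite addrAC subrr add0r normrN gtr0_norm.
(* [del * B] bounds the change of value at both endpoints; the summand [1] makes the estimate
   strict. *)
pose B := 1 + \sum_(j < size f) (`|u + h| ^+ j + `|u - h| ^+ j).
have B0 : 0 < B.
  by rewrite ltr_pwDl // sumr_ge0 // => j _; rewrite addr_ge0 // exprn_ge0.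
pose del := Num.min f.[u + h] (- f.[u - h]) / B.
have del0 : 0 < del by rewrite divr_gt0 // lt_min fp oppr_gt0 fm.
exists del => // g sg gf.
have close c : `|c| = `|u + h| \/ `|c| = `|u - h| -> `|g.[c] - f.[c]| < del * B.
  move=> Hc; rewrite (horner_coef_wide c sg) horner_coef -sumrB.
  apply: le_lt_trans (ler_norm_sum _ _ _) _.
  apply: (@le_lt_trans _ _ (\sum_(j < size f) del * (`|u + h| ^+ j + `|u - h| ^+ j))).
    apply: ler_sum => j _; rewrite -mulrBl normrM normrX.
    apply: ler_pM => //; [exact: exprn_ge0|exact: ltW|].
    by case: Hc => ->; rewrite ?lerDl ?lerDr exprn_ge0.
  by rewrite -mulr_sumr ltr_pM2l // /B ltrDr.
have delB : del * B = Num.min f.[u + h] (- f.[u - h]) by rewrite /del divfK ?gt_eqF.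
have gp : 0 <= g.[u + h].
  have := close _ (or_introl erefl); rewrite delB lt_min ltr_norml => /andP[/andP[H _] _].
  by move: H; set a := g.[_]; set b' := f.[_] => *; lra.
have gm : g.[u - h] <= 0.
  have := close _ (or_intror erefl); rewrite delB lt_min !ltr_norml => /andP[_ /andP[_ H]].
  by move: H; set a := g.[_]; set b' := f.[_] => *; lra.
have [||x /andP[x1 x2] /rootP gx] := @poly_ivt _ g (u - h) (u + h).
- by apply: le_trans (_ : u <= _); rewrite ?lerDl ?gerBl ltW.
- by rewrite gm gp.
exists x => //; apply: le_trans he; rewrite ler_norml.
by apply/andP; split; lra.
Qed.

Lemma root_perturb (R : realType) (f : {poly R}) (u e : R) :
  f.[u] = 0 -> f^`().[u] != 0 -> 0 < e ->
  exists2 del : R, 0 < del & forall g : {poly R}, (size g <= size f)%N ->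
    (forall j, `|g`_j - f`_j| < del) -> exists2 u', `|u' - u| <= e & g.[u'] = 0.
Proof.
move=> fu f'u e0; case: (ltrgt0P f^`().[u]) f'u => // f'u _.
  exact: root_perturb_pos.
have [|||del del0 H] := @root_perturb_pos R (- f) u e.
- by rewrite hornerN fu oppr0.
- by rewrite derivN hornerN oppr_gt0.
- by [].
exists del => // g sg gf; have [|j|u' u'u] := H (- g).
- by rewrite !size_polyN.
- by rewrite !coefN -opprD normrN.
by rewrite hornerN => /eqP; rewrite oppr_eq0 => /eqP gu'; exists u'.
Qed.

Lemma rat_approx (R : realType) (u e : R) : 0 < e -> exists q : rat, `|ratr q - u| <= e.
Proof.
move=> e0; have /rat_in_itvoo[q] : u - e < u + e by lra.
rewrite in_itv /= => /andP[H1 H2]; exists q; rewrite ler_norml.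
by apply/andP; split; move: H1 H2; set a := ratr q => *; lra.
Qed.

(* Either [u] is transcendental over the image of [phi], and any nearby rational
   will do, or [u] is a simple root of a polynomial of least degree, which keeps
   a nearby root when its coefficients move. *)
Lemma specialize_root (R : realType) (B : idomainType) (phi : {rmorphism B -> R})
    (u e : R) : 0 < e ->
  exists (bs : seq B) (del : R), 0 < del /\
    forall phi' : {rmorphism B -> R},
      (forall b, algebraicOver (ratr : rat -> R) (phi' b)) ->
      (forall b, phi b = 0 -> phi' b = 0) ->
      (forall b, b \in bs -> `|phi' b - phi b| < del) ->
    exists u' : R, [/\ algebraicOver (ratr : rat -> R) u', `|u' - u| <= e &
      forall p, (map_poly phi p).[u] = 0 -> (map_poly phi' p).[u'] = 0].
Proof.
move=> e0.
pose T (n : nat) := exists m : {poly B},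
  [/\ size m = n, phi (lead_coef m) != 0 & (map_poly phi m).[u] = 0].
(* Coefficients above the degree of the image are killed by [phi]; cutting them off gives a leading
   coefficient that survives. *)
have trunc (p : {poly B}) : map_poly phi p != 0 -> (map_poly phi p).[u] = 0 ->
    exists2 n, (n <= size p)%N & T n.
  move=> p0 pu; set n := size (map_poly phi p).
  have n0 : (0 < n)%N by rewrite lt0n size_poly_eq0.
  have pn : phi p`_n.-1 != 0 by rewrite -coef_map -lead_coefE lead_coef_eq0.
  have pn0 : p`_n.-1 != 0 by apply: contraNneq pn => ->; rewrite raddf0.
  exists n; first exact: size_poly.
  exists (\poly_(i < n) p`_i); split.
  - by rewrite size_poly_eq.
  - by rewrite lead_coefE size_poly_eq // coef_poly prednK // leqnn.
  rewrite -[RHS]pu; congr (_.[_]); apply/polyP => i.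
  rewrite !coef_map coef_poly; case: ltnP => // ni.
  by transitivity (0 : R); [exact: raddf0|rewrite -coef_map nth_default].
have [[n0 Tn0]|noT] := pselect (exists n, T n); last first.
  exists [::], 1; split => // phi' _ ker _.
  have [q Hq] := rat_approx u e0.
  exists (ratr q); split => //; first exact: algebraic_id.
  move=> p pu; have p0 : map_poly phi p = 0.
    apply/eqP; apply: contrapT => /negP p0; apply: noT.
    by have [n _ Tn] := trunc p p0 pu; exists n.
  suff -> : map_poly phi' p = 0 by rewrite horner0.
  by apply/polyP => i; rewrite coef_map coef0; apply: ker; rewrite -coef_map p0 coef0.
have [n [Tn nmin]] : exists n, T n /\ forall k, T k -> (n <= k)%N.
  have Tn0' : exists n, `[< T n >] by exists n0; apply/asboolP.
  exists (ex_minn Tn0'); case: ex_minnP => n /asboolP Tn H; split => // k Tk.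
  by apply: H; apply/asboolP.
have [m [sm lm mu]] := Tn.
have small (p : {poly B}) : (size p < n)%N -> (map_poly phi p).[u] = 0 -> map_poly phi p = 0.
  move=> spn pu; apply/eqP; apply: contrapT => /negP p0.
  have [k kp /nmin nk] := trunc p p0 pu.
  by have := leq_ltn_trans (leq_trans nk kp) spn; rewrite ltnn.
have m0 : m != 0 by apply: contraNneq lm => ->; rewrite lead_coef0 raddf0.
have spm : size (map_poly phi m) = n by rewrite size_map_poly_id0.
have n1 : (1 < n)%N.
  rewrite ltnNge; apply/negP => n1; have Dm : m = (m`_0)%:P.
    by apply: size1_polyC; rewrite sm.
  by move: mu lm; rewrite Dm map_polyC hornerC lead_coefC => ->; rewrite eqxx.
have m'u : (map_poly phi m)^`().[u] != 0.
  rewrite deriv_map; apply/eqP => /small H.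
  have : (map_poly phi m^`())`_n.-2 != 0.
    rewrite -deriv_map coef_deriv prednK ?ltn_predRL // coef_map mulrn_eq0 negb_or.
    rewrite -sm -lead_coefE lm andbT -lt0n sm; by case: (n) n1 => [|[]].
  rewrite H ?coef0 ?eqxx //.
  by apply: leq_trans (lt_size_deriv m0) _; rewrite sm.
have [del del0 Hdel] := root_perturb mu m'u e0.
(* The second bound keeps the leading coefficient nonzero under [phi']. *)
pose del' := Num.min del `|phi (lead_coef m)|.
exists m, del'; split; first by rewrite lt_min del0 normr_gt0.
move=> phi' alg ker close.
have lm' : phi' (lead_coef m) != 0.
  apply/eqP => lm'; have := close (lead_coef m).
  rewrite lm' sub0r normrN lt_min ltxx andbF => H.
  by suff : false by []; apply: H; rewrite lead_coefE mem_nth // sm ltn_predL ltnW.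
have pm' : map_poly phi' m != 0.
  by rewrite -size_poly_eq0 size_map_poly_id0 // size_poly_eq0.
have [||u' u'u mu'] := Hdel (map_poly phi' m).
- by rewrite spm -sm size_poly.
- move=> j; rewrite !coef_map; have [jm|jm] := ltnP j (size m).
    by have := close _ (mem_nth 0 jm); rewrite lt_min => /andP[].
  by rewrite (_ : m`_j = 0) ?nth_default // !raddf0 addr0 normr0.
exists u'; split => //.
  apply/integral_algebraic; apply: (integral_root pm'); first exact/rootP.
  move=> _ /(nthP 0)[i _ <-]; rewrite coef_map; apply/integral_algebraic; exact: alg.
move=> p pu.
(* Pseudo-division by [m]: by minimality of [n], the remainder vanishes at [u] only if [phi] kills
   its coefficients, and then [phi'] kills them too. *)
have E := Pdiv.Idomain.divp_eq p m.
have rem0 : map_poly phi (p %% m) = 0.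
  apply: small; first by rewrite -sm Pdiv.Idomain.ltn_modp.
  move/(congr1 (fun q => (map_poly phi q).[u])): E.
  rewrite map_polyZ rmorphD rmorphM /= !hornerE pu mu mulr0 mulr0 add0r.
  by move=> <-.
move/(congr1 (fun q => (map_poly phi' q).[u'])): E.
rewrite map_polyZ rmorphD rmorphM /= !hornerE mu' mulr0 add0r.
have -> : map_poly phi' (p %% m) = 0.
  by apply/polyP => i; rewrite coef_map coef0; apply: ker; rewrite -coef_map rem0 coef0.
rewrite horner0 rmorphXn /= => /eqP; rewrite mulf_eq0 expf_eq0 (negPf lm') andbF /=.
by move/eqP.
Qed.

Lemma mmap_continuous (R : realType) n (p : mpoly n int) :
  continuous (fun v : 'rV[R]_n => mmap intr (fun i => v 0 i) p).
Proof.
have contD (f g : 'rV[R]_n -> R) : continuous f -> continuous g ->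
    continuous (fun v => f v + g v).
  by move=> fc gc v; exact: (continuousD (fc v) (gc v)).
have contM (f g : 'rV[R]_n -> R) : continuous f -> continuous g ->
    continuous (fun v => f v * g v).
  by move=> fc gc v; exact: (continuousM (fc v) (gc v)).
have contX m : continuous (fun v : 'rV[R]_n => mmap1 (fun i => v 0 i) m).
  rewrite /mmap1; elim: (index_enum _) => [|i l IHl].
    rewrite (_ : (fun _ => _) = cst 1); first exact: cst_continuous.
    by apply/funext => v; rewrite big_nil.
  rewrite (_ : (fun _ => _) = (fun v : 'rV[R]_n => v 0 i ^+ m i * \prod_(j <- l) v 0 j ^+ m j)).
    apply: (contM _ _) => //; elim: (m i) => [|k IHk]; first exact: cst_continuous.
    rewrite (_ : (fun _ => _) = (fun w : 'rV[R]_n => w 0 i * w 0 i ^+ k)).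
      by apply: (contM _ _) => //; exact: coord_continuous.
    by apply/funext => w; rewrite exprS.
  by apply/funext => v; rewrite big_cons.
rewrite /mmap; elim: (msupp p) => [|m s IH].
  rewrite (_ : (fun _ => _) = cst 0); first exact: cst_continuous.
  by apply/funext => v; rewrite big_nil.
rewrite (_ : (fun _ => _) = (fun v : 'rV[R]_n => (mcoeff m p)%:~R * mmap1 (fun i => v 0 i) m +
  \sum_(j <- s) (mcoeff j p)%:~R * mmap1 (fun i => v 0 i) j)).
  by apply: (contD _ _) => //; apply: (contM _ _) => //; exact: cst_continuous.
by apply/funext => v; rewrite big_cons.
Qed.

Lemma mmap_close (R : realType) n (r : 'I_n -> R) (ps : seq (mpoly n int)) (e : R) :
  0 < e -> exists2 del : R, 0 < del & forall r' : 'I_n -> R,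
    (forall i, `|r' i - r i| < del) ->
    forall p, p \in ps -> `|mmap intr r' p - mmap intr r p| < e.
Proof.
move=> e0; elim: ps => [|p ps [del del0 IH]]; first by exists 1.
pose v : 'rV[R]_n := \row_i r i.
have : \forall w \near (v : 'rV[R]_n), `|mmap intr (fun i => v 0 i) p - mmap intr (fun i => (w : 'rV[R]_n) 0 i) p| < e.
  by have := @mmap_continuous R n p v; move/cvgrPdist_lt; apply.
move/nbhs_ballP => [d2 /= d20 H].
exists (Num.min del d2); first by rewrite lt_min del0.
move=> r' Hr' q; rewrite inE => /orP[/eqP ->|qps]; last first.
  by apply: IH => // i; have := Hr' i; rewrite lt_min => /andP[].
have := H (\row_i r' i); rewrite /v distrC.
have -> : (fun i => (\row_i0 r i0) 0 i) = r by apply/funext => i; rewrite mxE.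
have -> : (fun i => (\row_i0 r' i0) 0 i) = r' by apply/funext => i; rewrite mxE.
apply; split => // i j; rewrite ord1 !mxE /ball /= distrC.
by have := Hr' j; rewrite lt_min => /andP[].
Qed.

Lemma mmap_muni (R : realType) n (r : 'I_n.+1 -> R) (p : mpoly n.+1 int) :
  mmap intr r p =
  (map_poly (mmap intr (fun i => r (widen_ord (leqnSn n) i))) (muni p)).[r ord_max].
Proof.
rewrite muniE rmorph_sum /= horner_sum {1}/mmap; apply: eq_bigr => m _.
rewrite !map_polyZ /= rmorphXn /= map_polyX !hornerE.
rewrite mmapZ mmapX -mulrA; congr (_ * _).
rewrite /mmap1 big_ord_recr /=; congr (_ * _).
by apply: eq_bigr => i _; rewrite mnmE.
Qed.

Lemma algebraic_mmap (R : realType) n (r : 'I_n -> R) (p : mpoly n int) :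
  (forall i, algebraicOver (ratr : rat -> R) (r i)) ->
  algebraicOver (ratr : rat -> R) (mmap intr r p).
Proof.
move=> alg; rewrite /mmap; elim/big_ind: _ => [|x y|m _].
- exact: algebraic0.
- exact: algebraic_add.
apply: algebraic_mul; first by rewrite -[_%:~R]ratr_int; exact: algebraic_id.
rewrite /mmap1; elim/big_ind: _ => [|x y|i _]; [exact: algebraic1|exact: algebraic_mul|].
by elim: (m i) => [|k IH]; rewrite ?expr0 ?exprS; [exact: algebraic1|exact: algebraic_mul].
Qed.

Lemma algebraic_specialization (R : realType) n (r : 'I_n -> R) (e : R) : 0 < e ->
  exists r' : 'I_n -> R, [/\ forall i, algebraicOver (ratr : rat -> R) (r' i),
    forall i, `|r' i - r i| <= e &
    forall p : mpoly n int, mmap intr r p = 0 -> mmap intr r' p = 0].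
Proof.
elim: n r e => [|n IH] r e e0.
  by exists r; split => // -[].
pose s i := r (widen_ord (leqnSn n) i).
(* The last coordinate is treated first: its list [bs] dictates how close the other coordinates have
   to stay. *)
have [bs [del [del0 Hdel]]] := specialize_root (mmap intr s) (r ord_max) e0.
have [eta eta0 Heta] := mmap_close s bs del0.
pose eta' := Num.min e (eta / 2).
have [|s' [algs s's Is]] := IH s eta' _; first by rewrite lt_min e0 divr_gt0.
have [|||u [algu uu Iu]] := Hdel (mmap intr s').
- by move=> p; apply: algebraic_mmap.
- exact: Is.
- move=> p pbs; apply: Heta => // i; apply: le_lt_trans (s's i) _.
  by rewrite gt_min ltr_pdivrMr // ltr_pMr // ltr1n orbT.
pose r' (i : 'I_n.+1) := if unlift ord_max i is Some j then s' j else u.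
have r'w i : r' (widen_ord (leqnSn n) i) = s' i.
  have -> : widen_ord (leqnSn n) i = lift ord_max i by apply: val_inj; rewrite /= /bump leqNgt ltn_ord.
  by rewrite /r' liftK.
have r'm : r' ord_max = u by rewrite /r' unlift_none.
exists r'; split.
- by move=> i; rewrite /r'; case: unliftP.
- move=> i; rewrite /r'; case: unliftP => [j ->|->] //.
  have -> : lift ord_max j = widen_ord (leqnSn n) j by apply: val_inj; rewrite /= /bump leqNgt ltn_ord.
  by apply: le_trans (s's j) _; rewrite ge_min lexx.
move=> p; rewrite !mmap_muni r'm => /Iu; by have -> : (fun i => r' (widen_ord (leqnSn n) i)) = s' by apply/funext.
Qed.

(** * Generated substructures *)

Section Generated.
Variables (F : fieldType) (A : set F).

Lemma generated_subring_ind (Q : F -> Prop) :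
  Q 1 -> (forall x y, Q x -> Q y -> Q (x - y)) ->
  (forall x y, Q x -> Q y -> Q (x * y)) -> A `<=` Q ->
  generated_subring A `<=` Q.
Proof.
move=> Q1 QB QM QA x /(_ [set y | Q y]); apply; split => //.
by split=> [|y z|y z]; rewrite !inE //; [exact: QB|exact: QM].
Qed.

Lemma generated_subring_gen : A `<=` generated_subring A.
Proof. by move=> x Ax S [_]; exact. Qed.

Lemma generated_subringB x y : generated_subring A x ->
  generated_subring A y -> generated_subring A (x - y).
Proof.
move=> Hx Hy S HS; have [[_ SB _] _] := HS.
by have := SB x y; rewrite !inE; apply; [exact: Hx|exact: Hy].
Qed.

Lemma generated_subringM x y : generated_subring A x ->
  generated_subring A y -> generated_subring A (x * y).
Proof.
move=> Hx Hy S HS; have [[_ _ SM] _] := HS.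
by have := SM x y; rewrite !inE; apply; [exact: Hx|exact: Hy].
Qed.

Lemma generated_subring1 : generated_subring A 1.
Proof. by move=> S [[S1 _ _] _]; have := S1; rewrite inE. Qed.

Lemma generated_cone_ind (Q : F -> Prop) :
  Q 0 -> (forall x y, Q x -> Q y -> Q (x + y)) ->
  (forall x y, Q x -> Q y -> Q (x * y)) -> A `<=` Q ->
  generated_cone A `<=` Q.
Proof.
move=> Q0 QD QM QA x /(_ [set y | Q y]); apply; split => //; split.
  by split=> [|y z]; rewrite !inE //; exact: QD.
by move=> y z; rewrite !inE; exact: QM.
Qed.

Lemma generated_cone_gen : A `<=` generated_cone A.
Proof. by move=> x Ax S [_]; exact. Qed.

Lemma generated_cone0 : generated_cone A 0.
Proof. by move=> S [[[S0 _] _] _]; have := S0; rewrite inE. Qed.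

Lemma generated_coneD x y : generated_cone A x ->
  generated_cone A y -> generated_cone A (x + y).
Proof.
move=> Hx Hy S HS; have [[[_ SD] _] _] := HS.
by have := SD x y; rewrite !inE; apply; [exact: Hx|exact: Hy].
Qed.

Lemma generated_coneM x y : generated_cone A x ->
  generated_cone A y -> generated_cone A (x * y).
Proof.
move=> Hx Hy S HS; have [[_ SM] _] := HS.
by have := SM x y; rewrite !inE; apply; [exact: Hx|exact: Hy].
Qed.

Lemma rat_span_ind (Q : F -> Prop) :
  Q 0 -> (forall x y, Q x -> Q y -> Q (x - y)) ->
  (forall (q : rat) x, Q x -> Q (ratr q * x)) -> A `<=` Q ->
  rat_span A `<=` Q.
Proof.
move=> Q0 QB QZ QA x /(_ [set y | Q y]); apply; split => //; split.
  by split=> [|y z]; rewrite !inE //; exact: QB.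
by move=> q y; exact: QZ.
Qed.

Lemma rat_span_gen (q : rat) x : A x -> rat_span A (ratr q * x).
Proof. by move=> Ax S [[_ SZ] SA]; apply: SZ; exact: SA. Qed.

Lemma nonneg_rat_span_ind (Q : F -> Prop) :
  Q 0 -> (forall x y, Q x -> Q y -> Q (x + y)) ->
  (forall (q : rat) x, 0 <= q -> Q x -> Q (ratr q * x)) -> A `<=` Q ->
  nonneg_rat_span A `<=` Q.
Proof.
move=> Q0 QD QZ QA x /(_ [set y | Q y]); apply; split => //; split.
  by split=> [|y z]; rewrite !inE //; exact: QD.
by move=> q y q0; exact: QZ.
Qed.

Lemma nonneg_rat_span_gen (q : rat) x : 0 <= q -> A x ->
  nonneg_rat_span A (ratr q * x).
Proof. by move=> q0 Ax S [[_ SZ] SA]; apply: SZ => //; exact: SA. Qed.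

End Generated.

Lemma generated_subgroup_ind (V : zmodType) (A : set V) (Q : V -> Prop) :
  Q 0 -> (forall x y, Q x -> Q y -> Q (x - y)) -> A `<=` Q ->
  generated_subgroup A `<=` Q.
Proof.
move=> Q0 QB QA x /(_ [set y | Q y]); apply; split => //.
by split=> [|y z]; rewrite !inE //; exact: QB.
Qed.

(** * Fractions [g / P^k] *)

Lemma mpoly_scale_int d (c : int) (p : mpoly d int) : c *: p = p *~ c.
Proof.
by rewrite -mul_mpolyC -[c in mpolyC _ c]intz rmorph_int mulrzl.
Qed.

Section ClearDenominators.
Variables (d : nat) (P : laurent d).

Definition lshift_exp : nat := \max_(w <- finsupp P) \max_(i < d) absz (w i).

(* [x^(mexp w)] is [x^w] shifted by a monomial clearing all negative exponents
   of [P]; [mpoly_of] is the shift of [P] itself. *)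
Definition mexp (w : {ffun 'I_d -> int}) : multinom d :=
  Multinom (mktuple (fun i => absz (w i + lshift_exp%:Z))).

Definition mpoly_of : mpoly d int :=
  \sum_(w <- finsupp P) P w *: mpolyX int (mexp w).

Lemma mexpE w i : w \in finsupp P -> (mexp w i)%:Z = w i + lshift_exp%:Z.
Proof.
move=> wP; rewrite /mexp mnmE gez0_abs //.
have H : (absz (w i) <= lshift_exp)%N.
  rewrite /lshift_exp (big_rem w) //= leq_max; apply/orP; left.
  exact: (leq_bigmax i).
by move: (w i : int) H => z H; lia.
Qed.

Section Evaluation.
Variables (K : fieldType) (f : {rmorphism mpoly d int -> K}).
Let x i := f (mpolyX int (mnm1 i)).
Hypothesis x_neq0 : forall i, x i != 0.

Lemma rmorph_mpolyX m : f (mpolyX int m) = \prod_i x i ^+ m i.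
Proof.
by rewrite mpolyXE_id rmorph_prod; apply: eq_bigr => i _; rewrite rmorphXn.
Qed.

Lemma rmorph_mexp w : w \in finsupp P ->
  f (mpolyX int (mexp w)) = monom x w * \prod_i x i ^+ lshift_exp.
Proof.
move=> wP; rewrite rmorph_mpolyX /monom -big_split /=; apply: eq_bigr => i _.
by rewrite exprnP mexpE // exprzDr ?unitfE.
Qed.

(** Valid for any homomorphism nonzero on the variables, so it serves both the embedding into
    rational functions and the evaluation at a point. *)
Lemma rmorph_mpoly_of : f mpoly_of = leval x P * \prod_i x i ^+ lshift_exp.
Proof.
rewrite /mpoly_of rmorph_sum /leval mulr_suml big_seq [RHS]big_seq.
apply: eq_bigr => w wP.
by rewrite mpoly_scale_int rmorphMz /= rmorph_mexp // -mulrzl mulrA.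
Qed.

Lemma monom_ratio w : w \in finsupp P ->
  monom x w / leval x P = f (mpolyX int (mexp w)) / f mpoly_of.
Proof.
move=> wP; rewrite rmorph_mexp // rmorph_mpoly_of -mulf_div divff ?mulr1 //.
by apply/prodf_neq0 => i _; rewrite expf_neq0.
Qed.

End Evaluation.

Lemma monom_gt0 (K : realFieldType) (x : 'I_d -> K) w :
  (forall i, 0 < x i) -> 0 < monom x w.
Proof. by move=> x0; apply: prodr_gt0 => i _; exact: exprz_gt0. Qed.

Hypothesis P_nonneg : nonneg_laurent P.

Lemma coef_gt0 w : w \in finsupp P -> 0 < P w.
Proof. by rewrite mem_finsupp lt_neqAle eq_sym => ->; case: P_nonneg => ->. Qed.

Lemma leval_gt0 (K : realFieldType) (x : 'I_d -> K) :
  (forall i, 0 < x i) -> 0 < leval x P.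
Proof.
move=> x0; have [_ [w Pw]] := P_nonneg.
have wP : w \in finsupp P by rewrite mem_finsupp.
rewrite /leval (bigD1_seq w) //= ?fset_uniq //.
have pos v : v \in finsupp P -> 0 < (P v)%:~R * monom x v.
  by move=> vP; rewrite mulr_gt0 ?monom_gt0 // ltr0z coef_gt0.
apply: ltr_pwDl; first exact: pos.
by rewrite big_seq_cond; apply: sumr_ge0 => v /andP[vP _]; by apply: ltW; exact: pos.
Qed.

Lemma mpoly_of_neq0 : mpoly_of != 0.
Proof.
pose f : {rmorphism mpoly d int -> rat} := mmap intr (fun=> 1).
have fX i : f (mpolyX int (mnm1 i)) = 1 by rewrite /f /= mmapX mmap1U.
suff : f mpoly_of != 0 by apply: contraNneq => ->; rewrite raddf0.
have f0 i : f (mpolyX int (mnm1 i)) != 0 by rewrite fX oner_neq0.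
rewrite rmorph_mpoly_of // mulf_neq0 //.
  by apply/lt0r_neq0/leval_gt0 => i; rewrite fX.
by apply/prodf_neq0 => i _; rewrite expf_neq0.
Qed.

Lemma indet_neq0 i : @indet d i != 0.
Proof.
rewrite /indet tofrac_eq0; apply/eqP => /(congr1 (mcoeff (mnm1 i))).
by rewrite mcoeffX eqxx mcoeff0.
Qed.

Lemma tofrac_mpoly_of_neq0 : tofrac mpoly_of != 0.
Proof. by rewrite tofrac_eq0 mpoly_of_neq0. Qed.

Lemma leval_indet_neq0 : leval (@indet d) P != 0.
Proof.
have := tofrac_mpoly_of_neq0; have := @rmorph_mpoly_of _ (@tofrac _) indet_neq0.
by move=> ->; apply: contraNneq => /= ->; rewrite mul0r.
Qed.

Definition gen (w : {ffun 'I_d -> int}) : ratfun d :=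
  monom (@indet d) w / leval (@indet d) P.

Definition hform (k : nat) (g : mpoly d int) : ratfun d :=
  tofrac g / tofrac mpoly_of ^+ k.

Lemma gen_hform w : w \in finsupp P -> gen w = hform 1 (mpolyX int (mexp w)).
Proof. by move=> wP; rewrite /gen /hform (monom_ratio indet_neq0). Qed.

Lemma hformD k : {morph hform k : g h / g + h}.
Proof. by move=> g h; rewrite /hform rmorphD mulrDl. Qed.

Lemma hformN k : {morph hform k : g / - g}.
Proof. by move=> g; rewrite /hform rmorphN mulNr. Qed.

Lemma hform0 k : hform k 0 = 0.
Proof. by rewrite /hform raddf0 mul0r. Qed.

Lemma hform_mulrz k (c : int) g : hform k (g *~ c) = hform k g *~ c.
Proof. by rewrite /hform rmorphMz mulrzAl. Qed.

Lemma hform_sum k (I : Type) (s : seq I) (g : I -> mpoly d int) :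
  hform k (\sum_(i <- s) g i) = \sum_(i <- s) hform k (g i).
Proof. by rewrite /hform rmorph_sum mulr_suml. Qed.

Lemma hformM k l g h : hform k g * hform l h = hform (k + l) (g * h).
Proof. by rewrite /hform mulf_div rmorphM exprD. Qed.

Lemma hform_widen k l g : hform (k + l) (g * mpoly_of ^+ l) = hform k g.
Proof.
rewrite /hform rmorphM rmorphXn exprD -mulf_div divff ?mulr1 //.
by rewrite expf_neq0 // tofrac_mpoly_of_neq0.
Qed.

Lemma hform_inj k : injective (hform k).
Proof.
move=> g h; move/(congr1 (fun t => t * tofrac mpoly_of ^+ k)).
rewrite /hform !mulfVK ?expf_neq0 ?tofrac_mpoly_of_neq0 //.
by move/eqP; rewrite tofrac_eq => /eqP.
Qed.

(** The [k]-fold sumset of the shifted [Log P], which is the set of exponents of [P^k] since nothing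
    cancels. Elements of [R_P] are the [g / P^k] whose numerator has its exponents there. *)
Inductive homk : nat -> multinom d -> Prop :=
| homk0 : homk 0 mnm0
| homkS k w m : w \in finsupp P -> homk k m -> homk k.+1 (mnm_add (mexp w) m).

Lemma homkD k l m n : homk k m -> homk l n -> homk (k + l) (mnm_add m n).
Proof.
elim=> [|k' w m' wP _ IH] Hn; first by rewrite add0m.
by rewrite addSn -addmA; apply: homkS => //; exact: IH.
Qed.

Definition homog (k : nat) (g : mpoly d int) : Prop :=
  forall m, mcoeff m g != 0 -> homk k m.

Definition nonneg_mpoly (g : mpoly d int) : Prop := forall m, 0 <= mcoeff m g.

Lemma homog0 k : homog k 0.
Proof. by move=> m; rewrite mcoeff0 eqxx. Qed.

Lemma homogD k g h : homog k g -> homog k h -> homog k (g + h).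
Proof.
move=> Hg Hh m; rewrite mcoeffD; have [->|g0] := eqVneq (mcoeff m g) 0.
  by rewrite add0r; exact: Hh.
by move=> _; exact: Hg.
Qed.

Lemma homogN k g : homog k g -> homog k (- g).
Proof. by move=> Hg m; rewrite mcoeffN oppr_eq0; exact: Hg. Qed.

Lemma homogM k l g h : homog k g -> homog l h -> homog (k + l) (g * h).
Proof.
move=> Hg Hh m; rewrite -mcoeff_msupp => /msuppM_le /allpairsP[[m1 m2] /= []].
by rewrite !mcoeff_msupp => /Hg H1 /Hh H2 ->; exact: homkD.
Qed.

Lemma homogX k m : homk k m -> homog k (mpolyX int m).
Proof. by move=> Hm n; rewrite mcoeffX; case: (eqVneq m n) => [<- //|_]; rewrite eqxx. Qed.

Lemma homogMz k g (c : int) : homog k g -> homog k (g *~ c).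
Proof.
move=> Hg m; rewrite -mpoly_scale_int mcoeffZ mulf_eq0 negb_or => /andP[_].
exact: Hg.
Qed.

Lemma homk1 w : w \in finsupp P -> homk 1 (mexp w).
Proof. by move=> wP; rewrite -[mexp w]addm0; apply: homkS => //; exact: homk0. Qed.

Lemma homog_mpoly_of : homog 1 mpoly_of.
Proof.
rewrite /mpoly_of big_seq; elim/big_ind: _ => [|g h|w wP].
- exact: homog0.
- exact: homogD.
- by rewrite mpoly_scale_int; apply/homogMz/homogX/homk1.
Qed.

Lemma homog1 : homog 0 1.
Proof. by rewrite -mpolyX0; apply/homogX/homk0. Qed.

Lemma homog_exp k : homog k (mpoly_of ^+ k).
Proof.
elim: k => [|k IH]; first exact: homog1.
by rewrite exprS -add1n; apply: homogM => //; exact: homog_mpoly_of.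
Qed.

Lemma nonneg_mpolyD g h : nonneg_mpoly g -> nonneg_mpoly h -> nonneg_mpoly (g + h).
Proof. by move=> Hg Hh m; rewrite mcoeffD addr_ge0. Qed.

Lemma nonneg_mpolyM g h : nonneg_mpoly g -> nonneg_mpoly h -> nonneg_mpoly (g * h).
Proof. by move=> Hg Hh m; rewrite mcoeffM sumr_ge0 // => k _; rewrite mulr_ge0. Qed.

Lemma nonneg_mpolyX m : nonneg_mpoly (mpolyX int m).
Proof. by move=> n; rewrite mcoeffX ler0n. Qed.

Lemma nonneg_mpoly_of : nonneg_mpoly mpoly_of.
Proof.
move=> m; rewrite /mpoly_of raddf_sum /= sumr_ge0 // => w _.
by rewrite mcoeffZ mulr_ge0 ?nonneg_mpolyX //; case: P_nonneg.
Qed.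

Lemma nonneg_mpoly_exp k : nonneg_mpoly (mpoly_of ^+ k).
Proof.
elim: k => [|k IH]; first by rewrite expr0 -mpolyX0; exact: nonneg_mpolyX.
by rewrite exprS; apply: nonneg_mpolyM => //; exact: nonneg_mpoly_of.
Qed.

(** * Monomials in the [x^w/P] and the positive cone *)

Inductive gmon : ratfun d -> Prop :=
| gmon1 : gmon 1
| gmonS w f : w \in finsupp P -> gmon f -> gmon (gen w * f).

Lemma gmonM f g : gmon f -> gmon g -> gmon (f * g).
Proof.
elim=> [|w f' wP _ IH] Hg; first by rewrite mul1r.
by rewrite -mulrA; apply: gmonS => //; exact: IH.
Qed.

Lemma gmon_gen w : w \in finsupp P -> gmon (gen w).
Proof. by move=> wP; rewrite -[gen w]mulr1; apply: gmonS => //; exact: gmon1. Qed.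

Lemma gmon_homk k m : homk k m -> gmon (hform k (mpolyX int m)).
Proof.
elim=> [|k' w m' wP _ IH].
  by rewrite /hform mpolyX0 rmorph1 expr0 divr1; exact: gmon1.
by rewrite mpolyXD -add1n -hformM -gen_hform //; apply: gmonS.
Qed.

Lemma gmon_hform f : gmon f -> exists k m, homk k m /\ f = hform k (mpolyX int m).
Proof.
elim=> [|w f' wP _ [k [m [Hm ->]]]].
  by exists 0, mnm0; split; [exact: homk0|rewrite /hform mpolyX0 rmorph1 expr0 divr1].
exists k.+1, (mnm_add (mexp w) m); split; first exact: homkS.
by rewrite gen_hform // hformM mpolyXD.
Qed.

Lemma gmon_neq0 f : gmon f -> f != 0.
Proof.
elim=> [|w f' wP _ IH]; first exact: oner_neq0.
apply: mulf_neq0; last exact: IH.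
apply: mulf_neq0; last by rewrite invr_eq0 leval_indet_neq0.
by apply/prodf_neq0 => i _; apply: expfz_neq0; exact: indet_neq0.
Qed.

Lemma ratios_gen f : ratios (@indet d) P f <-> exists2 w, w \in finsupp P & f = gen w.
Proof.
split=> [[w Pw <-]|[w wP ->]]; exists w => //; last by rewrite /Log /= -mem_finsupp.
by rewrite mem_finsupp.
Qed.

Lemma sum_gen : \sum_(w <- finsupp P) gen w *~ P w = 1.
Proof.
rewrite -(divff leval_indet_neq0) {2}/leval mulr_suml; apply: eq_bigr => w _.
by rewrite /gen -mulrzl mulrA.
Qed.

Let C := generated_cone (ratios (@indet d) P).

Lemma cone_mulrz f (c : int) : 0 <= c -> C f -> C (f *~ c).
Proof.
case: c => // n _ Cf; rewrite -pmulrn; elim: n => [|n IH].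
  by rewrite mulr0n; exact: generated_cone0.
by rewrite mulrS; exact: generated_coneD.
Qed.

Lemma cone_sum (I : eqType) (s : seq I) (g : I -> ratfun d) :
  (forall i, i \in s -> C (g i)) -> C (\sum_(i <- s) g i).
Proof.
move=> H; rewrite big_seq; elim/big_ind: _ => //.
- exact: generated_cone0.
- by move=> x y; exact: generated_coneD.
Qed.

Lemma cone_gen w : w \in finsupp P -> C (gen w).
Proof. by move=> wP; apply: generated_cone_gen; apply/ratios_gen; exists w. Qed.

Lemma cone1 : C 1.
Proof.
rewrite -sum_gen; apply: cone_sum => w wP; apply: cone_mulrz.
  by case: P_nonneg.
exact: cone_gen.
Qed.

Lemma cone_gmon f : gmon f -> C f.
Proof.
by elim=> [|w g wP _ IH]; [exact: cone1|apply: generated_coneM => //; exact: cone_gen].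
Qed.

Lemma cone_hform k g : homog k g -> nonneg_mpoly g -> C (hform k g).
Proof.
move=> Hg g0; rewrite {1}(mpolyE g) hform_sum; apply: cone_sum => m.
rewrite mcoeff_msupp => /Hg Hm.
by rewrite mpoly_scale_int hform_mulrz; apply: cone_mulrz; [exact: g0|apply: cone_gmon; exact: gmon_homk].
Qed.

Lemma cone_gmon_sum f : C f ->
  exists2 s : seq (ratfun d), (forall g, g \in s -> gmon g) & f = \sum_(g <- s) g.
Proof.
move: f; apply: generated_cone_ind.
- by exists [::] => //; rewrite big_nil.
- move=> _ _ [s Hs ->] [t Ht ->]; exists (s ++ t); last by rewrite big_cat.
  by move=> g; rewrite mem_cat => /orP[/Hs|/Ht].
- move=> _ _ [s Hs ->] [t Ht ->]; exists [seq x * y | x <- s, y <- t].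
    by move=> g /allpairsP[[x y] /= [/Hs Hx /Ht Hy ->]]; exact: gmonM.
  rewrite big_allpairs_dep mulr_suml; apply: eq_bigr => x _.
  by rewrite mulr_sumr.
- move=> f /ratios_gen[w wP ->]; exists [:: gen w]; last by rewrite big_seq1.
  by move=> g; rewrite inE => /eqP ->; exact: gmon_gen.
Qed.

Lemma cone_rep f : C f -> exists k g, [/\ homog k g, nonneg_mpoly g & f = hform k g].
Proof.
move=> /cone_gmon_sum[s Hs ->]; rewrite big_seq; elim/big_ind: _ => [|x y|g /Hs].
- by exists 0, 0; split; [exact: homog0|by move=> m; rewrite mcoeff0|rewrite hform0].
- move=> [k [g [Hg g0 ->]]] [l [h [Hh h0 ->]]].
  exists (k + l)%N, (g * mpoly_of ^+ l + h * mpoly_of ^+ k); split.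
  + by apply: homogD; [|rewrite addnC]; apply: homogM => //; exact: homog_exp.
  + by apply: nonneg_mpolyD; apply: nonneg_mpolyM => //; exact: nonneg_mpoly_exp.
  + by rewrite hformD hform_widen addnC hform_widen.
- move=> /gmon_hform[k [m [Hm ->]]]; exists k, (mpolyX int m).
  by split; [exact: homogX|exact: nonneg_mpolyX|].
Qed.

Lemma RP_pred_rep f : f \in RP_pred P -> exists k g, homog k g /\ f = hform k g.
Proof.
rewrite inE; move: f; apply: generated_subring_ind.
- by exists 0, 1; split; [exact: homog1|rewrite /hform rmorph1 expr0 divr1].
- move=> _ _ [k [g [Hg ->]]] [l [h [Hh ->]]].
  exists (k + l)%N, (g * mpoly_of ^+ l - h * mpoly_of ^+ k); split.
    by apply: homogD; [|apply: homogN; rewrite addnC]; apply: homogM => //; exact: homog_exp.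
  by rewrite hformD hformN hform_widen addnC hform_widen.
- move=> _ _ [k [g [Hg ->]]] [l [h [Hh ->]]].
  by exists (k + l)%N, (g * h); split; [exact: homogM|rewrite hformM].
- move=> f /ratios_gen[w wP ->]; exists 1, (mpolyX int (mexp w)).
  by split; [exact/homogX/homk1|exact: gen_hform].
Qed.

Lemma RP_pred_cone f : C f -> f \in RP_pred P.
Proof.
move: f; apply: generated_cone_ind => [|x y|x y|x xr].
- exact: rpred0.
- exact: rpredD.
- exact: rpredM.
- by rewrite inE; exact: generated_subring_gen.
Qed.

(** Over a common denominator the numerators have integer coefficients, whose signs are unaffected
    by the factor [N]. *)
Lemma cone_unperforated f N : f \in RP_pred P -> (0 < N)%N -> C (f *+ N) -> C f.
Proof.
move=> /RP_pred_rep[k [g [Hg ->]]] N0 /cone_rep[l [h [Hh h0 E]]].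
rewrite -(hform_widen k l); apply: cone_hform.
  by apply: homogM => //; exact: homog_exp.
have {}E : (g * mpoly_of ^+ l) *~ N = h * mpoly_of ^+ k.
  apply: (@hform_inj (k + l)%N); rewrite hform_mulrz hform_widen addnC hform_widen.
  by rewrite -E -pmulrn.
move=> m; have : 0 <= mcoeff m (h * mpoly_of ^+ k).
  by apply: nonneg_mpolyM => //; exact: nonneg_mpoly_exp.
by rewrite -E -mpoly_scale_int mcoeffZ pmulr_rge0.
Qed.

(* Coefficientwise, [0 <= a <= x^v/P] forces the exponents of the numerator of
   [a] into [v + Log P^k]. *)
Lemma interval_gen v f : v \in finsupp P -> C f -> C (gen v - f) ->
  exists2 z, z \in RP_pred P & f = gen v * z.
Proof.
move=> vP /cone_rep[k [g [Hg g0 Ef]]] /cone_rep[l [h [Hh h0 Eh]]].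
have Ev : hform k g + hform l h = hform 1 (mpolyX int (mexp v)).
  by rewrite -Ef -Eh -gen_hform // addrC subrK.
have E : g * mpoly_of ^+ l.+1 + h * mpoly_of ^+ k.+1 =
    mpolyX int (mexp v) * mpoly_of ^+ (k + l).
  apply: (@hform_inj (k + l).+1); rewrite hformD.
  have -> : hform (k + l).+1 (g * mpoly_of ^+ l.+1) = hform k g.
    by rewrite -addnS hform_widen.
  have -> : hform (k + l).+1 (h * mpoly_of ^+ k.+1) = hform l h.
    by rewrite (addnC k l) -addnS hform_widen.
  by rewrite -add1n hform_widen.
set G := g * _ in E.
have HG m : mcoeff m G != 0 ->
    exists2 m', homk (k + l) m' & m = mnm_add (mexp v) m'.
  move=> Gm.
  have : mcoeff m (mpolyX int (mexp v) * mpoly_of ^+ (k + l)) != 0.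
    rewrite -E mcoeffD paddr_eq0 ?negb_and ?Gm //.
      by apply: nonneg_mpolyM => //; exact: nonneg_mpoly_exp.
    by apply: nonneg_mpolyM => //; exact: nonneg_mpoly_exp.
  rewrite -mcoeff_msupp => /msuppM_le /allpairsP[[m1 m2] /= []].
  by rewrite msuppX inE => /eqP -> H2 ->; exists m2 => //; apply: homog_exp; rewrite -mcoeff_msupp.
rewrite Ef -(hform_widen k l.+1) -/G (mpolyE G) hform_sum big_seq.
elim/big_ind: _ => [|_ _ [x xR ->] [y yR ->]|m].
- by exists 0; [exact: rpred0|rewrite mulr0].
- by exists (x + y); [exact: rpredD|rewrite mulrDr].
rewrite mcoeff_msupp => /HG[m' Hm' ->].
exists (hform (k + l) (mpolyX int m') *~ mcoeff (mnm_add (mexp v) m') G).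
  by apply: rpredMz; apply: RP_pred_cone; apply: cone_gmon; exact: gmon_homk.
by rewrite mpoly_scale_int hform_mulrz mpolyXD addnS -add1n -hformM -gen_hform // mulrzAr.
Qed.

Lemma cone_archimedean f : f \in RP_pred P ->
  exists n : nat, C (n%:R - f) /\ C (n%:R + f).
Proof.
have Cn n : C n%:R.
  by rewrite -[n%:R]/(1 *~ n%:Z) ; apply: cone_mulrz => //; exact: cone1.
rewrite inE; move: f; apply: generated_subring_ind.
- exists 1%N; rewrite subrr; split; first exact: generated_cone0.
  exact: (Cn 2).
- move=> f g [n [n1 n2]] [m [m1 m2]]; exists (n + m)%N; rewrite natrD; split.
    have -> : n%:R + m%:R - (f - g) = (n%:R - f) + (m%:R + g) by ring.
    exact: generated_coneD.
  have -> : n%:R + m%:R + (f - g) = (n%:R + f) + (m%:R - g) by ring.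
  exact: generated_coneD.
(* Two-sided bounds of the factors bound the product; [3] counts the terms [n m] produced by the
   identities below. *)
- move=> f g [n [n1 n2]] [m [m1 m2]]; exists (3 * (n * m))%N; split.
    have -> : (3 * (n * m))%:R - f * g = (n%:R + f) * (m%:R - g) + n%:R * (m%:R + g) + m%:R * (n%:R - f).
      by rewrite !natrM; ring.
    by do 2!(apply: generated_coneD; last by apply: generated_coneM => //; exact: Cn);
      exact: generated_coneM.
  have -> : (3 * (n * m))%:R + f * g = (n%:R - f) * (m%:R - g) + n%:R * (m%:R + g) + m%:R * (n%:R + f).
    by rewrite !natrM; ring.
  by do 2!(apply: generated_coneD; last by apply: generated_coneM => //; exact: Cn);
    exact: generated_coneM.
- move=> f /ratios_gen[w wP ->]; exists 1%N; split; last first.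
    by apply: generated_coneD; [exact: cone1|exact: cone_gen].
  (* [1] is the sum of the [P(v) x^v/P], and the integer [P(w)] is at least [1]. *)
  rewrite -[1%:R]sum_gen (bigD1_seq w) //= ?fset_uniq //.
  rewrite addrAC; apply: generated_coneD.
    rewrite -{2}[gen w]mulr1z -mulrzBr; apply: cone_mulrz; last exact: cone_gen.
    by have := coef_gt0 wP; lia.
  rewrite -big_filter; apply: cone_sum => v; rewrite mem_filter => /andP[_ vP].
  by apply: cone_mulrz; [apply/ltW/coef_gt0|apply: cone_gen].
Qed.

End ClearDenominators.

(** * Evaluation at a point *)

Lemma monomD d (F : fieldType) (x : 'I_d -> F) u v : (forall i, x i != 0) ->
  monom x (u + v) = monom x u * monom x v.
Proof.
move=> x0; rewrite /monom -big_split; apply: eq_bigr => i _.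
by rewrite ffunE expfzDr.
Qed.

Lemma monomN d (F : fieldType) (x : 'I_d -> F) u :
  monom x (- u) = (monom x u)^-1.
Proof.
rewrite /monom -prodfV; apply: eq_bigr => i _.
by rewrite ffunE invr_expz.
Qed.

Lemma monom0 d (F : fieldType) (x : 'I_d -> F) : monom x 0 = 1.
Proof. by rewrite /monom big1 // => i _; rewrite ffunE expr0z. Qed.

Lemma leval_wide d (F : fieldType) (x : 'I_d -> F) (L : laurent d)
    (S : {fset {ffun 'I_d -> int}}) : fsubset (finsupp L) S ->
  leval x L = \sum_(w <- S) (L w)%:~R * monom x w.
Proof.
move=> LS; rewrite /leval; apply: big_fset_incl => // w _.
by rewrite mem_finsupp negbK => /eqP ->; rewrite mul0r.
Qed.

Lemma leval_add_monom d (F : fieldType) (x : 'I_d -> F) (L : laurent d) (c : int) u :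
  exists L' : laurent d, leval x L' = leval x L + c%:~R * monom x u.
Proof.
pose S : {fset {ffun 'I_d -> int}} := (u |` finsupp L)%fset.
pose L' : laurent d := [fsfun w in S => L w + (if w == u then c else 0)].
exists L'; rewrite (@leval_wide _ _ _ L' S); last first.
  by apply/fsubsetP => w; rewrite mem_finsupp /L' fsfunE; case: ifP => //; rewrite eqxx.
rewrite (@leval_wide _ _ _ L S); last by apply/fsubsetP => w wL; rewrite !inE wL orbT.
have uS : u \in S by rewrite !inE eqxx.
rewrite [in RHS](big_fsetD1 u) //= (big_fsetD1 u) //= addrAC; congr (_ + _).
  by rewrite /L' fsfunE uS eqxx intrD mulrDl.
apply: eq_big_seq => w; rewrite !inE => /andP[wu wS].
by rewrite /L' fsfunE !inE wS (negPf wu) addr0.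
Qed.

Lemma frac_eq_cross (F : fieldType) (a b c e : F) : b != 0 -> e != 0 ->
  a / b = c / e -> a * e = c * b.
Proof. by move=> b0 e0 /eqP; rewrite eqr_div // => /eqP. Qed.

Section Specialization.
Variables (R : realType) (d : nat) (r : 'I_d -> R).
Hypothesis r_neq0 : forall i, r i != 0.

Let ev : {rmorphism mpoly d int -> R} := mmap intr r.

(* A relation, as evaluation at [r] is partial on rational functions. *)
Definition spec (f : ratfun d) (t : R) : Prop :=
  exists n m, [/\ mmap intr r m != 0, f = tofrac n / tofrac m &
    t = mmap intr r n / mmap intr r m].

Lemma tofrac_neq0 m : ev m != 0 -> tofrac m != 0.
Proof. by apply: contraNneq => /eqP; rewrite tofrac_eq0 => /eqP ->; rewrite raddf0. Qed.

Lemma spec_unique f t t' : spec f t -> spec f t' -> t = t'.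
Proof.
move=> [n [m [m0 -> ->]]] [n' [m' [m'0 E ->]]].
have := tofrac_neq0 m0; have := tofrac_neq0 m'0 => fm' fm.
move: (frac_eq_cross fm fm' E); rewrite -!tofracM => /eqP; rewrite tofrac_eq => /eqP /(congr1 ev).
by rewrite !rmorphM /= => E'; apply/eqP; rewrite eqr_div //; apply/eqP.
Qed.

Lemma specD f g s t : spec f s -> spec g t -> spec (f + g) (s + t).
Proof.
move=> [n [m [m0 -> ->]]] [n' [m' [m'0 -> ->]]].
exists (n * m' + n' * m), (m * m'); split.
- by rewrite (rmorphM ev) mulf_neq0.
- by rewrite tofracD !tofracM; apply: addf_div; exact: tofrac_neq0.
- by rewrite (rmorphD ev) !(rmorphM ev) addf_div.
Qed.

Lemma specM f g s t : spec f s -> spec g t -> spec (f * g) (s * t).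
Proof.
move=> [n [m [m0 -> ->]]] [n' [m' [m'0 -> ->]]].
exists (n * n'), (m * m'); split.
- by rewrite (rmorphM ev) mulf_neq0.
- by rewrite !tofracM mulf_div.
- by rewrite !(rmorphM ev) mulf_div.
Qed.

Lemma spec_mpoly n : spec (tofrac n) (ev n).
Proof.
exists n, 1; split; first by rewrite (rmorph1 ev) oner_neq0.
  by rewrite tofrac1 divr1.
by rewrite (rmorph1 ev) divr1.
Qed.

Lemma spec_int (c : int) : spec c%:~R c%:~R.
Proof. by have := spec_mpoly c%:~R; rewrite !rmorph_int. Qed.

Lemma specN f s : spec f s -> spec (- f) (- s).
Proof.
by move=> H; rewrite -mulN1r -[- s]mulN1r; apply: specM => //; exact: (spec_int (-1)).
Qed.

Lemma specV f t : t != 0 -> spec f t -> spec f^-1 t^-1.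
Proof.
move=> t0 [n [m [m0 -> Et]]]; exists m, n; split.
- by apply: contraNneq t0 => n0; rewrite Et n0 mul0r.
- by rewrite invf_div.
- by rewrite Et invf_div.
Qed.

Lemma specX f t k : spec f t -> spec (f ^+ k) (t ^+ k).
Proof.
move=> H; elim: k => [|k IH]; first exact: (spec_int 1).
by rewrite !exprS; exact: specM.
Qed.

Lemma spec_monom u : spec (monom (@indet d) u) (monom r u).
Proof.
rewrite /monom; elim/big_ind2: _ => [|x1 x2 y1 y2|i _].
- exact: (spec_int 1).
- exact: specM.
have Hi : spec (indet i) (r i).
  by have := spec_mpoly (mpolyX int (mnm1 i)); rewrite /ev /= mmapX mmap1U.
case: (u i) => k; first exact: specX.
by rewrite NegzE /= -!exprnN; apply: specV; [rewrite expf_neq0|exact: specX].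
Qed.

Lemma spec_leval (L : laurent d) : spec (leval (@indet d) L) (leval r L).
Proof.
rewrite /leval; elim/big_ind2: _ => [|x1 x2 y1 y2|w _].
- exact: (spec_int 0).
- exact: specD.
- by apply: specM; [exact: spec_int|exact: spec_monom].
Qed.

End Specialization.

Lemma laurent_of_mpoly d (g : mpoly d int) u :
  exists L : laurent d, leval (@indet d) L = tofrac g * monom (@indet d) u.
Proof.
elim/mpolyind: g => [|c m p _ _ [L HL]].
  by exists [fsfun]; rewrite /leval finsupp0 big_seq_fset0 tofrac0 mul0r.
pose v : {ffun 'I_d -> int} := [ffun i => (m i)%:Z].
have [L' HL'] := leval_add_monom (@indet d) L c (v + u).
exists L'; rewrite HL' HL tofracD mulrDl addrC; congr (_ + _).
rewrite mpoly_scale_int rmorphMz /= -(mulrzl (tofrac (mpolyX int m)) c) -mulrA; congr (_ * _).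
rewrite monomD; last exact: indet_neq0.
congr (_ * _); rewrite (rmorph_mpolyX (@tofrac _)) /monom.
by apply: eq_bigr => i _; rewrite ffunE.
Qed.

Section TauPoint.
Variables (R : realType) (d : nat) (P : laurent d) (r : 'I_d -> R).
Hypothesis P_nonneg : nonneg_laurent P.
Hypothesis r_gt0 : positive_point r.

Let r_neq0 i : r i != 0. Proof. by rewrite gt_eqF. Qed.

Let leval_neq0 : leval r P != 0.
Proof. by rewrite gt_eqF // leval_gt0. Qed.

Lemma tau_pt_laurent (a : RP P) : exists (g : laurent d) (k : nat),
  RP_val a = leval (@indet d) g / leval (@indet d) P ^+ k.
Proof.
have [k [g [_ ->]]] := RP_pred_rep P_nonneg (RP_valP a).
(* This exponent undoes the shift contained in [mpoly_of ^+ k]. *)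
pose u : {ffun 'I_d -> int} := [ffun i => - (lshift_exp P * k)%N%:Z].
have [L HL] := laurent_of_mpoly g u; exists L, k.
rewrite HL /hform (rmorph_mpoly_of _ (@indet_neq0 d)) exprMn invfM mulrA.
rewrite [RHS]mulrAC; congr (_ * _).
rewrite /monom -prodrXl -prodfV; apply: eq_bigr => i _.
by rewrite ffunE -exprM -exprnN.
Qed.

(** Clearing denominators inhabits the set behind [xget], and uniqueness of [spec] makes it a
    singleton; any fraction may then be used to compute the value. *)
Lemma tau_pt_spec (a : RP P) t : spec r (RP_val a) t -> tau_pt r a = t.
Proof.
move=> Ht; rewrite /tau_pt; case: xgetP => [s -> [g [k [Ea ->]]]|].
  apply: (spec_unique (f := RP_val a)) Ht; rewrite Ea.
  apply: specM; first exact: spec_leval.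
  by apply: specV; [rewrite expf_neq0|apply: specX; exact: spec_leval].
have [g [k E]] := tau_pt_laurent a => /(_ (leval r g / leval r P ^+ k)); case.
by exists g, k.
Qed.

Lemma spec_tau_pt (a : RP P) : spec r (RP_val a) (tau_pt r a).
Proof.
have [g [k E]] := tau_pt_laurent a.
have H : spec r (RP_val a) (leval r g / leval r P ^+ k).
  rewrite E; apply: specM; first exact: spec_leval.
  by apply: specV; [rewrite expf_neq0|apply: specX; exact: spec_leval].
by rewrite (tau_pt_spec H).
Qed.

Lemma tau_pt_zmod_morphism : zmod_morphism (tau_pt r : RP P -> R).
Proof.
move=> a b; apply: tau_pt_spec; rewrite [RP_val _](rmorphB (val : RP P -> _)).
by apply: specD; [|apply: specN]; exact: spec_tau_pt.
Qed.

Lemma tau_pt_monoid_morphism : monoid_morphism (tau_pt r : RP P -> R).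
Proof.
split=> [|a b]; apply: tau_pt_spec.
  by rewrite [RP_val _](rmorph1 (val : RP P -> _)); exact: (spec_int r 1).
rewrite [RP_val _](rmorphM (val : RP P -> _)).
by apply: specM; exact: spec_tau_pt.
Qed.

Definition tau_hom : {rmorphism RP P -> R} := HB.pack (tau_pt r : RP P -> R)
  (GRing.isZmodMorphism.Build _ _ _ tau_pt_zmod_morphism)
  (GRing.isMonoidMorphism.Build _ _ _ tau_pt_monoid_morphism).

Lemma tau_pt_hform (a : RP P) k g : RP_val a = hform P k g ->
  tau_pt r a = mmap intr r g / mmap intr r (mpoly_of P) ^+ k.
Proof.
move=> Ea; apply: tau_pt_spec; rewrite Ea; apply: specM; first exact: spec_mpoly.
apply: specV; last by apply: specX; exact: spec_mpoly.
have rX : (fun i => mmap intr r (mpolyX int (mnm1 i))) = r.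
  by apply/funext => i; rewrite mmapX mmap1U.
rewrite expf_neq0 // (rmorph_mpoly_of P (f := mmap intr r)) => [|i] /=; last first.
  by rewrite mmapX mmap1U.
rewrite rX mulf_neq0 //; apply/prodf_neq0 => i _.
by rewrite expf_neq0 // mmapX mmap1U.
Qed.

Lemma tau_pt_ratio (a : RP P) w : RP_val a = gen P w ->
  tau_pt r a = monom r w / leval r P.
Proof.
move=> Ea; apply: tau_pt_spec; rewrite Ea; apply: specM; first exact: spec_monom.
by apply: specV => //; exact: spec_leval.
Qed.

End TauPoint.

(** * The ordered ring [R_P] *)

Section DimensionGroup.
Variables (d : nat) (P : laurent d).
Hypothesis P_nonneg : nonneg_laurent P.

Let C : set (RP P) := @RP_pos d P.

Lemma RP_posE (a : RP P) :
  RP_pos a = generated_cone (ratios (@indet d) P) (RP_val a).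
Proof. by []. Qed.

Lemma RP_valB (a b : RP P) : RP_val (a - b) = RP_val a - RP_val b.
Proof. exact: (rmorphB (val : RP P -> _)). Qed.

Lemma RP_valD (a b : RP P) : RP_val (a + b) = RP_val a + RP_val b.
Proof. exact: (rmorphD (val : RP P -> _)). Qed.

Lemma RP_valM (a b : RP P) : RP_val (a * b) = RP_val a * RP_val b.
Proof. by rewrite [LHS](rmorphM (val : RP P -> _)). Qed.

Lemma RP_val1 : RP_val (1 : RP P) = 1.
Proof. exact: (rmorph1 (val : RP P -> _)). Qed.

Lemma RP_val0 : RP_val (0 : RP P) = 0.
Proof. exact: (raddf0 (val : RP P -> _)). Qed.

Lemma RP_val_natmul (a : RP P) n : RP_val (a *+ n) = RP_val a *+ n.
Proof. exact: (raddfMn (val : RP P -> _)). Qed.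

Lemma RP_val_nat n : RP_val (n%:R : RP P) = n%:R.
Proof. by rewrite RP_val_natmul RP_val1. Qed.

Lemma RP_val_mulrz (a : RP P) (c : int) : RP_val (a *~ c) = RP_val a *~ c.
Proof. exact: (raddfMz (val : RP P -> _)). Qed.

Lemma RP_val_inj : injective (@RP_val d P).
Proof. exact: val_inj. Qed.

Definition RPgen (w : {ffun 'I_d -> int}) : RP P := insubd (0 : RP P) (gen P w).

Lemma RPgenE w : w \in finsupp P -> RP_val (RPgen w) = gen P w.
Proof.
move=> wP; rewrite /RPgen [LHS]insubdK //.
by apply: RP_pred_cone; exact: cone_gen.
Qed.

Lemma RP_ind (Q : RP P -> Prop) :
  Q 1 -> (forall a b, Q a -> Q b -> Q (a - b)) ->
  (forall a b, Q a -> Q b -> Q (a * b)) ->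
  (forall w, w \in finsupp P -> Q (RPgen w)) -> forall a, Q a.
Proof.
move=> Q1 QB QM Qg a.
have [b Qb E] : exists2 b : RP P, Q b & RP_val a = RP_val b.
  have := RP_valP a; rewrite inE; move: (RP_val a); apply: generated_subring_ind.
  - by exists 1 => //; rewrite RP_val1.
  - move=> _ _ [x Qx ->] [y Qy ->]; exists (x - y); first exact: QB.
    by rewrite RP_valB.
  - move=> _ _ [x Qx ->] [y Qy ->]; exists (x * y); first exact: QM.
    by rewrite RP_valM.
  - move=> f /ratios_gen[w wP ->]; exists (RPgen w); first exact: Qg.
    by rewrite RPgenE.
by rewrite (RP_val_inj E).
Qed.

Inductive RPmon : RP P -> Prop :=
| RPmon1 : RPmon 1
| RPmonS w a : w \in finsupp P -> RPmon a -> RPmon (RPgen w * a).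

Lemma RPmon_gen w : w \in finsupp P -> RPmon (RPgen w).
Proof. by move=> wP; rewrite -[RPgen w]mulr1; apply: RPmonS => //; exact: RPmon1. Qed.

Lemma RPmonM a b : RPmon a -> RPmon b -> RPmon (a * b).
Proof.
elim=> [|w a' wP _ IH] Hb; first by rewrite mul1r.
by rewrite -mulrA; apply: RPmonS => //; exact: IH.
Qed.

Lemma gmon_RPmon f : gmon P f -> exists2 a, RPmon a & RP_val a = f.
Proof.
elim=> [|w g wP _ [a Ha <-]]; first by exists 1; [exact: RPmon1|exact: RP_val1].
by exists (RPgen w * a); [exact: RPmonS|rewrite RP_valM RPgenE].
Qed.

Lemma RPmon_gmon a : RPmon a -> gmon P (RP_val a).
Proof.
elim=> [|w b wP _ IH]; first by rewrite RP_val1; exact: gmon1.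
by rewrite RP_valM RPgenE //; exact: gmonS.
Qed.

Lemma RPmon_neq0 a : RPmon a -> a <> 0.
Proof.
by move=> /RPmon_gmon/(gmon_neq0 P_nonneg) H E; move: H; rewrite E RP_val0 eqxx.
Qed.

Lemma RP_pos_mon a : RPmon a -> C a.
Proof. by move=> Ha; apply: cone_gmon => //; exact: RPmon_gmon. Qed.

Lemma RP_pos_gen w : w \in finsupp P -> C (RPgen w).
Proof. by move=> wP; apply: RP_pos_mon; exact: RPmon_gen. Qed.

Lemma RP_pos_ind (Q : RP P -> Prop) :
  Q 0 -> (forall a b, C a -> C b -> Q a -> Q b -> Q (a + b)) ->
  (forall a, RPmon a -> Q a) -> forall a, C a -> Q a.
Proof.
move=> Q0 QD Qm a /cone_gmon_sum[s Hs E].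
have [b [_ Qb Eb]] : exists b : RP P, [/\ C b, Q b & RP_val b = \sum_(g <- s) g].
  rewrite big_seq; elim/big_ind: _ => [|_ _ [x [Cx Qx <-]] [y [Cy Qy <-]]|g /Hs].
  - by exists 0; split; [rewrite /C RP_posE RP_val0; exact: generated_cone0|exact: Q0|exact: RP_val0].
  - exists (x + y); split; [|exact: QD|exact: RP_valD].
    by rewrite /C RP_posE RP_valD; exact: generated_coneD.
  - by move=> /gmon_RPmon[x Hx <-]; exists x; split; [exact: RP_pos_mon|exact: Qm|].
by rewrite (RP_val_inj (etrans E (esym Eb))).
Qed.

Lemma RP_pos_semicone : semicone C.
Proof.
split.
- by move=> a b Ca Cb; rewrite /C RP_posE RP_valD; exact: generated_coneD.
- by move=> a b Ca Cb; rewrite /C RP_posE RP_valM; exact: generated_coneM.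
- move=> n; rewrite /C RP_posE RP_val_nat.
  by rewrite -[n%:R]/(1 *~ n%:Z); apply: cone_mulrz => //; exact: cone1.
- move=> a; have [n [Hn _]] := cone_archimedean P_nonneg (RP_valP a).
  by exists n; rewrite /C RP_posE RP_valB RP_val_nat.
Qed.

Lemma RP_pos_unperforated a N : (0 < N)%N -> C (a *+ N) -> C a.
Proof.
move=> N0; rewrite /C RP_posE RP_val_natmul.
exact: (cone_unperforated P_nonneg (RP_valP a)).
Qed.

Lemma RP_interval_gen v a : v \in finsupp P -> C a -> C (RPgen v - a) ->
  exists z, a = RPgen v * z.
Proof.
move=> vP Ca; rewrite /C RP_posE RP_valB RPgenE // => Cva.
have [z zP E] := interval_gen P_nonneg vP Ca Cva.
by exists (MkRP zP); apply: RP_val_inj; rewrite RP_valM RPgenE.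
Qed.

Lemma sum_RPgen : \sum_(w <- finsupp P) RPgen w *~ P w = 1.
Proof.
apply: RP_val_inj; rewrite RP_val1 -(sum_gen P_nonneg).
rewrite [LHS](raddf_sum (val : RP P -> _)) big_seq [RHS]big_seq.
by apply: eq_bigr => w wP; rewrite [LHS]RP_val_mulrz RPgenE.
Qed.

Hypothesis P_faithful : projectively_faithful P.

(** Projective faithfulness enters here: [x^(v - w)] is the quotient of [x^v/P] by [x^w/P], and
    these differences generate all exponents. *)
Lemma monom_quotient u : exists a b : RP P, [/\ RPmon a, RPmon b &
  monom (@indet d) u * RP_val b = RP_val a].
Proof.
have : generated_subgroup [set v - w | v in Log P & w in Log P] u.
  by rewrite P_faithful.
have x0 := @indet_neq0 d.
move: u; apply: generated_subgroup_ind.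
- exists 1, 1; split; [exact: RPmon1|exact: RPmon1|].
  by rewrite monom0 mul1r.
- move=> u v [a [b [Ha Hb E]]] [a' [b' [Ha' Hb' E']]].
  exists (a * b'), (b * a'); split; [exact: RPmonM|exact: RPmonM|].
  rewrite !RP_valM monomD // monomN -E -E' mulrACA.
  have /negPf m0 : monom (@indet d) v != 0.
    by apply/prodf_neq0 => i _; apply: expfz_neq0; exact: x0.
  by congr (_ * _); rewrite mulrA mulVf ?mul1r // m0.
- move=> _ [v Pv [w Pw <-]].
  have vP : v \in finsupp P by rewrite mem_finsupp.
  have wP : w \in finsupp P by rewrite mem_finsupp.
  exists (RPgen v), (RPgen w); split; [exact: RPmon_gen|exact: RPmon_gen|].
  rewrite !RPgenE // /gen monomD // monomN mulrA; congr (_ * _).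
  have m0 : monom (@indet d) w != 0.
    by apply/prodf_neq0 => i _; apply: expfz_neq0; exact: x0.
  by rewrite -mulrA mulVf ?mulr1.
Qed.

Lemma mpoly_quotient (p : mpoly d int) : exists a b : RP P, RPmon b /\
  tofrac p * RP_val b = RP_val a.
Proof.
elim/mpolyind: p => [|c m p _ _ [a [b [Hb E]]]].
  by exists 0, 1; split; [exact: RPmon1|rewrite tofrac0 mul0r RP_val0].
have [a' [b' [_ Hb' E']]] := monom_quotient [ffun i => (m i)%:Z].
exists (a' * b *~ c + a * b'), (b * b'); split; first exact: RPmonM.
rewrite mpoly_scale_int RP_valD RP_val_mulrz !RP_valM -E -E' tofracD mulrDl.
have -> : monom (@indet d) [ffun i => (m i)%:Z] = tofrac (mpolyX int m).
  rewrite (rmorph_mpolyX (@tofrac _)) /monom.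
  by apply: eq_bigr => i _; rewrite ffunE.
rewrite mulrA; congr (_ + _); last by rewrite mulrA.
have -> : tofrac (mpolyX int m *~ c) = tofrac (mpolyX int m) *~ c.
  exact: (raddfMz (@tofrac _)).
by rewrite !mulrzAl mulrAC.
Qed.

(** * Positive homomorphisms as points *)

Section Homs.
Variable R : realType.

(* A positive homomorphism that vanishes on no [x^w/P] extends to the monomials
   [x^u], and its values on the coordinates give the point. *)
Lemma positive_hom_point (sigma : {rmorphism RP P -> R}) :
  (forall w, w \in finsupp P -> 0 < sigma (RPgen w)) ->
  exists2 r : 'I_d -> R, positive_point r & forall a, sigma a = tau_pt r a.
Proof.
move=> pos.
have mon_pos a : RPmon a -> 0 < sigma a.
  elim=> [|w b wP _ IH]; first by rewrite rmorph1.
  by rewrite rmorphM mulr_gt0 // pos.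
(* The value that [sigma] forces on [x^u]; a relation, because [x^u] need not lie in [R_P]. *)
pose rel u t := exists a b : RP P, [/\ RPmon a, RPmon b,
  monom (@indet d) u * RP_val b = RP_val a & t = sigma a / sigma b].
have x0 := @indet_neq0 d.
have rel_fun u t t' : rel u t -> rel u t' -> t = t'.
  move=> [a [b [Ha Hb E ->]]] [a' [b' [Ha' Hb' E' ->]]].
  have sb := lt0r_neq0 (mon_pos _ Hb); have sb' := lt0r_neq0 (mon_pos _ Hb').
  apply/eqP; rewrite eqr_div // -!(rmorphM sigma); apply/eqP; congr (sigma _).
  by apply: RP_val_inj; rewrite !RP_valM -E -E' mulrAC.
have relD u v s t : rel u s -> rel v t -> rel (u + v) (s * t).
  move=> [a [b [Ha Hb E ->]]] [a' [b' [Ha' Hb' E' ->]]].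
  exists (a * a'), (b * b'); split; [exact: RPmonM|exact: RPmonM| |].
    by rewrite !RP_valM -E -E' monomD // mulrACA.
  by rewrite mulf_div !rmorphM.
have relN u t : rel u t -> rel (- u) t^-1.
  move=> [a [b [Ha Hb E ->]]]; exists b, a; split=> //; last by rewrite invf_div.
  have m0 : monom (@indet d) u != 0.
    by apply/prodf_neq0 => i _; apply: expfz_neq0; exact: x0.
  by rewrite -E monomN mulrA mulVf ?mul1r.
have rel0 : rel 0 1.
  exists 1, 1; split; [exact: RPmon1|exact: RPmon1|by rewrite monom0 mul1r|].
  by rewrite rmorph1 divr1.
have rel_ex u : exists t, rel u t.
  by have [a [b [Ha Hb E]]] := monom_quotient u; exists (sigma a / sigma b), a, b.
have rel_pos u t : rel u t -> 0 < t.
  by move=> [a [b [Ha Hb _ ->]]]; rewrite divr_gt0 // mon_pos.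
pose e (i : 'I_d) : {ffun 'I_d -> int} := [ffun j => (i == j)%:Z].
have /choice[r Hr] : forall i, exists t, rel (e i) t by move=> i; exact: rel_ex.
have r0 : positive_point r by move=> i; exact: rel_pos (Hr i).
have relX u t n : rel u t -> rel (u *+ n) (t ^+ n).
  move=> H; elim: n => [|n IH]; first by rewrite mulr0n expr0.
  by rewrite mulrS exprS; exact: relD.
have relZ u t (n : int) : rel u t -> rel (u *~ n) (t ^ n).
  move=> H; case: n => n; first by rewrite -pmulrn; exact: relX.
  by rewrite NegzE mulrNz -pmulrn -exprnN; apply: relN; exact: relX.
have rel_monom u : rel u (monom r u).
  have {1}-> : u = \sum_i e i *~ u i.
    apply/ffunP => j; rewrite sum_ffunE (bigD1 j) //= big1 => [|i ij].
      by rewrite addr0 ffunMzE ffunE eqxx intz.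
    by rewrite ffunMzE ffunE (negPf ij) mul0rz.
  by rewrite /monom; elim/big_ind2: _ => // [x1 x2 y1 y2|i _]; [exact: relD|exact: relZ].
exists r => //.
have [_ [w Pw]] := P_nonneg.
have wP : w \in finsupp P by rewrite mem_finsupp.
(* The ratio of [sigma (x^v/P)] to [r^v] does not depend on [v]; the relation [sum P(v) x^v/P = 1]
   identifies it as [1 / P(r)]. *)
pose c := sigma (RPgen w) / monom r w.
have sigmac v : v \in finsupp P -> sigma (RPgen v) = c * monom r v.
  move=> vP; have H : rel (v - w) (sigma (RPgen v) / sigma (RPgen w)).
    exists (RPgen v), (RPgen w); split=> //; [exact: RPmon_gen|exact: RPmon_gen|].
    rewrite !RPgenE // /gen monomD // monomN mulrA; congr (_ * _).
    have m0 : monom (@indet d) w != 0.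
      by apply/prodf_neq0 => i _; apply: expfz_neq0; exact: x0.
    by rewrite -mulrA mulVf ?mulr1.
  have r0' i : r i != 0 by rewrite gt_eqF.
  have := rel_fun _ _ _ H (rel_monom (v - w)); rewrite monomD // monomN => E.
  have mw : monom r w != 0 by rewrite gt_eqF // monom_gt0.
  rewrite /c -[LHS](divfK (lt0r_neq0 (pos _ wP))) E; field.
  exact: mw.
have c1 : c * leval r P = 1.
  rewrite -(rmorph1 sigma) -sum_RPgen rmorph_sum /leval mulr_sumr big_seq [RHS]big_seq.
  apply: eq_bigr => v vP.
  by rewrite rmorphMz /= sigmac // -[RHS]mulrzl mulrCA.
have lP : leval r P != 0 by rewrite gt_eqF // leval_gt0.
have cE : c = (leval r P)^-1 by rewrite -[LHS](mulfK lP) c1 mul1r.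
move=> a; rewrite -[RHS]/(tau_hom P_nonneg r0 a); move: a; apply: RP_ind.
- by rewrite !rmorph1.
- by move=> a b Ea Eb; rewrite !rmorphB Ea Eb.
- by move=> a b Ea Eb; rewrite !rmorphM Ea Eb.
- move=> v vP; rewrite sigmac // /tau_hom /=.
  by rewrite (tau_pt_ratio P_nonneg r0 (RPgenE vP)) cE mulrC.
Qed.

Section Point.
Variable r : 'I_d -> R.
Hypothesis r0 : positive_point r.

Lemma tau_pt_gen w : w \in finsupp P ->
  tau_pt r (RPgen w) = monom r w / leval r P.
Proof. by move=> wP; apply: tau_pt_ratio => //; exact: RPgenE. Qed.

Lemma tau_pt_gen_gt0 w : w \in finsupp P -> 0 < tau_pt r (RPgen w).
Proof. by move=> wP; rewrite tau_pt_gen // divr_gt0 ?monom_gt0 ?leval_gt0. Qed.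

Lemma tau_pt_mon_gt0 a : RPmon a -> 0 < tau_pt r a.
Proof.
rewrite -[tau_pt r a]/(tau_hom P_nonneg r0 a).
elim=> [|w b wP _ IH]; first by rewrite rmorph1.
by rewrite rmorphM mulr_gt0 // tau_pt_gen_gt0.
Qed.

Lemma tau_pt_ge0 a : C a -> 0 <= tau_pt r a.
Proof.
rewrite -[tau_pt r a]/(tau_hom P_nonneg r0 a).
move: a; apply: RP_pos_ind; first by rewrite raddf0.
- by move=> a b _ _ Ha Hb; rewrite rmorphD addr_ge0.
- by move=> a Ha; apply: ltW; exact: tau_pt_mon_gt0.
Qed.

Lemma subring_tau_pt t :
  generated_subring (ratios r P) t <-> exists a : RP P, tau_pt r a = t.
Proof.
split=> [|[a <-]].
  move: t; apply: generated_subring_ind.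
  - by exists 1; rewrite -[tau_pt r 1]/(tau_hom P_nonneg r0 1) rmorph1.
  - move=> _ _ [a <-] [b <-]; exists (a - b).
    by rewrite -[LHS]/(tau_hom P_nonneg r0 _) rmorphB.
  - move=> _ _ [a <-] [b <-]; exists (a * b).
    by rewrite -[LHS]/(tau_hom P_nonneg r0 _) rmorphM.
  - move=> _ [w Pw <-]; exists (RPgen w); apply: tau_pt_gen.
    by rewrite mem_finsupp.
rewrite -[tau_pt r a]/(tau_hom P_nonneg r0 a).
move: a; apply: RP_ind => [|a b|a b|w wP].
- by rewrite rmorph1; exact: generated_subring1.
- by rewrite rmorphB; exact: generated_subringB.
- by rewrite rmorphM; exact: generated_subringM.
- rewrite [X in generated_subring _ X]tau_pt_gen //; apply: generated_subring_gen.
  by exists w => //; rewrite /Log /= -mem_finsupp.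
Qed.

End Point.

Lemma kernel_of_vanishing (r r' : 'I_d -> R) (a : RP P) : positive_point r -> positive_point r' ->
  (forall p : mpoly d int, mmap intr r p = 0 -> mmap intr r' p = 0) ->
  tau_pt r a = 0 -> tau_pt r' a = 0.
Proof.
move=> r0 r'0 I; have [k [g [_ E]]] := RP_pred_rep P_nonneg (RP_valP a).
rewrite (tau_pt_hform P_nonneg r0 E) (tau_pt_hform P_nonneg r'0 E).
have nz : mmap intr r (mpoly_of P) != 0.
  have rX : (fun i => mmap intr r (mpolyX int (mnm1 i))) = r.
    by apply/funext => i; rewrite mmapX mmap1U.
  rewrite (rmorph_mpoly_of P (f := mmap intr r)) => [|i] /=; last first.
    by rewrite mmapX mmap1U gt_eqF.
  rewrite rX mulf_neq0 ?gt_eqF ?leval_gt0 //.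
  by apply: prodr_gt0 => i _; rewrite exprn_gt0 // mmapX mmap1U.
move/eqP; rewrite mulf_eq0 invr_eq0 expf_eq0 (negPf nz) andbF orbF => /eqP /I ->.
by rewrite mul0r.
Qed.

(** A polynomial [p] need not lie in [R_P], but some multiple [p b] does, with [b] a monomial in the
    [x^w/P] and thus nonzero at every positive point. *)
Lemma vanishing_of_kernel (r r' : 'I_d -> R) : positive_point r -> positive_point r' ->
  (forall a : RP P, tau_pt r a = 0 -> tau_pt r' a = 0) ->
  forall p : mpoly d int, mmap intr r p = 0 -> mmap intr r' p = 0.
Proof.
move=> r0 r'0 J p pr; have [a [b [Hb E]]] := mpoly_quotient p.
have Ea s : positive_point s -> tau_pt s a = mmap intr s p * tau_pt s b.
  move=> s0; have sn0 i : s i != 0 by rewrite gt_eqF.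
  apply: tau_pt_spec => //; rewrite -E; apply: specM => //; first exact: spec_mpoly.
  exact: spec_tau_pt.
have := J a; rewrite !Ea // pr mul0r => /(_ erefl)/eqP.
by rewrite mulf_eq0 (gt_eqF (tau_pt_mon_gt0 r'0 Hb)) orbF => /eqP.
Qed.

End Homs.
End DimensionGroup.

(** * Homomorphisms killing the kernel of [tau_r] *)

(** The estimate [(1 - x)^k (1 + k x) <= 1] reduces the claim to the archimedean property. *)
Lemma bernoulli_small (R : archiRealFieldType) (x eta : R) :
  0 < x <= 1 -> 0 < eta -> exists k : nat, (1 - x) ^+ k <= eta.
Proof.
move=> /andP[x0 x1] eta0.
have bern k : (1 - x) ^+ k * (1 + k%:R * x) <= 1.
  elim: k => [|k IH]; first by rewrite expr0 mul0r addr0 mul1r.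
  apply: le_trans IH; rewrite exprSr -mulrA; apply: ler_wpM2l.
    by rewrite exprn_ge0 // subr_ge0.
  have -> : (1 - x) * (1 + k.+1%:R * x) = 1 + k%:R * x - k.+1%:R * x * x.
    by rewrite -natr1; ring.
  by rewrite gerBl !mulr_ge0 ?ler0n // ltW.
pose k := Num.bound `|(eta * x)^-1|; exists k.
have Hk : (eta * x)^-1 < k%:R.
  by apply: le_lt_trans (ler_norm _) _; exact: archi_boundP.
have kx : 1 <= eta * (1 + k%:R * x).
  move: Hk; rewrite -div1r ltr_pdivrMr ?mulr_gt0 // mulrCA => /ltW H.
  by apply: le_trans H _; rewrite mulrDr mulr1 lerDr ltW.
have p0 : 0 < 1 + k%:R * x by rewrite ltr_pwDl // mulr_ge0 // ltW.
by rewrite -(ler_pM2r p0); apply: le_trans (bern k) kx.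
Qed.

Lemma horner_int_rmorph (A B : comNzRingType) (s : {rmorphism A -> B}) (f : {poly int}) x :
  s (map_poly intr f).[x] = (map_poly intr f).[s x].
Proof.
rewrite -horner_map -map_poly_comp; congr (_.[_]).
by apply: eq_map_poly => z /=; rewrite rmorph_int.
Qed.

(** Powers of [X] can be cancelled because [x] is nonzero. The nonzero constant term excludes [0] as
    a root and makes [x] invertible up to an integer. *)
Lemma algebraic_int_root (R : realType) (x : R) :
  algebraicOver (ratr : rat -> R) x -> x != 0 ->
  exists f : {poly int}, f`_0 != 0 /\ (map_poly intr f).[x] = 0.
Proof.
move=> [p p0 px] x0.
have [q [a a0 Dp]] := rat_poly_scale p.
have q0 : q != 0.
  by apply: contraNneq p0 => q0; rewrite Dp q0 map_poly0 scaler0.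
have qx : (map_poly intr q).[x] = 0.
  move: px; rewrite Dp rootE map_polyZ /= hornerZ mulf_eq0 fmorph_eq0 invr_eq0 intr_eq0 (negPf a0) /=.
  rewrite -map_poly_comp /= => /eqP; congr (_.[_] = 0).
  by apply: eq_map_poly => z /=; rewrite ratr_int.
elim/poly_ind: q q0 qx {Dp} => [|q c IH]; first by rewrite eqxx.
have [->|c0] := eqVneq c 0.
  rewrite addr0 mulf_eq0 polyX_eq0 orbF => q0.
  rewrite rmorphM /= map_polyX hornerMX => /eqP; rewrite mulf_eq0 (negPf x0) orbF => /eqP.
  exact: IH.
by move=> _ qx; exists (q * 'X + c%:P); rewrite coefD coefMX coefC /= add0r.
Qed.

(** Positive points are real and integer polynomials commute with the embedding into the complex
    numbers, so the complex zero locus can be left behind. *)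
Lemma isolated_iff (R : realType) d (r : 'I_d -> R) : positive_point r ->
  (really_isolated r <-> forall r' : 'I_d -> R, positive_point r' ->
    (forall p : mpoly d int, mmap intr r p = 0 -> mmap intr r' p = 0) -> r' = r).
Proof.
move=> r0.
have mmapC (s : 'I_d -> R) p :
    mmap intr (complex_point s) p = real_complex R (mmap intr s p).
  rewrite /mmap [RHS]rmorph_sum; apply: eq_bigr => m _.
  rewrite [RHS]rmorphM [in RHS]rmorph_int; congr (_ * _).
  by rewrite /mmap1 [RHS]rmorph_prod; apply: eq_bigr => i _; rewrite [RHS]rmorphXn.
have cinj (s s' : 'I_d -> R) : complex_point s = complex_point s' -> s = s'.
  by move=> E; apply/funext => i; apply: complexI; exact: (congr1 (fun f => f i) E).
have zl (s : 'I_d -> R) : zero_locus r (complex_point s) <->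
    forall p : mpoly d int, mmap intr r p = 0 -> mmap intr s p = 0.
  split=> H p pr.
    by have := H p pr; rewrite mmapC -(rmorph0 (real_complex R)) => /complexI.
  by rewrite mmapC H // rmorph0.
split=> [iso r' r'0 I|H].
  have : (zero_locus r `&` (@complex_point R d @` @positive_point R d)) (complex_point r').
    by split; [exact/zl|exists r'].
  by rewrite iso => /cinj.
apply/seteqP; split=> [z [+ [s s0 E]]|_ ->].
  by rewrite -E => /zl I /=; rewrite (H s).
by split; [apply/zl|exists r].
Qed.

Lemma isolated_algebraic (R : realType) d (r : 'I_d -> R) : positive_point r ->
  really_isolated r -> forall i, algebraicOver (ratr : rat -> R) (r i).
Proof.
move=> r0 /(isolated_iff r0) iso.
(* Strictly below every [r i], also for [d = 0], so a point within [e] of [r] is positive and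
   isolation applies to it. *)
pose e := (1 + \sum_i (r i)^-1)^-1.
have s0 : 0 < 1 + \sum_i (r i)^-1.
  by rewrite ltr_pwDl // sumr_ge0 // => i _; rewrite invr_ge0 ltW.
have e0 : 0 < e by rewrite invr_gt0.
have er i : e < r i.
  rewrite -[r i]invrK ltf_pV2 ?posrE ?invr_gt0 // (bigD1 i) //= addrCA ltrDl.
  by rewrite ltr_pwDl // sumr_ge0 // => j _; rewrite invr_ge0 ltW.
have [r' [alg close I]] := algebraic_specialization r e0.
suff -> : r = r' by [].
symmetry; apply: iso => // i; have := close i; rewrite ler_norml => /andP[H _].
by have := er i; move: H; set x := r i; set y := r' i => *; lra.
Qed.

Lemma algebraic_monom (R : realType) d (r : 'I_d -> R) w :
  (forall i, algebraicOver (ratr : rat -> R) (r i)) ->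
  algebraicOver (ratr : rat -> R) (monom r w).
Proof.
move=> alg; rewrite /monom; elim/big_ind: _ => [|x y|i _].
- exact: algebraic1.
- exact: algebraic_mul.
have algX k : algebraicOver (ratr : rat -> R) (r i ^+ k).
  by elim: k => [|k IH]; rewrite ?expr0 ?exprS; [exact: algebraic1|exact: algebraic_mul].
by case: (w i) => k; [exact: algX|rewrite NegzE -exprnN; apply: algebraic_inv].
Qed.

Lemma algebraic_leval (R : realType) d (r : 'I_d -> R) (L : laurent d) :
  (forall i, algebraicOver (ratr : rat -> R) (r i)) ->
  algebraicOver (ratr : rat -> R) (leval r L).
Proof.
move=> alg; rewrite /leval; elim/big_ind: _ => [|x y|w _].
- exact: algebraic0.
- exact: algebraic_add.
by apply: algebraic_mul; [rewrite -[_%:~R]ratr_int; exact: algebraic_id|exact: algebraic_monom].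
Qed.

Section Main.
Variables (R : realType) (d : nat) (P : laurent d).
Hypothesis P_nonneg : nonneg_laurent P.
Hypothesis P_faithful : projectively_faithful P.
Hypothesis P_div : approximately_divisible R (@RP_pos d P) 1.

Let C : set (RP P) := @RP_pos d P.
Let Ccone : semicone C := RP_pos_semicone P_nonneg.
Let CD := semicone_add Ccone.
Let CM := semicone_mul Ccone.
Let Cn := semicone_nat Ccone.
Let Ca := semicone_arch Ccone.

Definition positive_hom (sigma : {rmorphism RP P -> R}) : Prop :=
  forall a, RP_pos a -> 0 <= sigma a.

Lemma positive_hom_state sigma : positive_hom sigma ->
  states (@RP_pos d P) 1 (sigma : RP P -> R).
Proof.
move=> s0; split; last exact: rmorph1.
split; [exact: rmorphD|exact: s0|exists 1; by rewrite rmorph1 oner_neq0].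
Qed.

Lemma positive_hom_bound a : exists n : nat,
  forall sigma, positive_hom sigma -> `|sigma a| <= n%:R.
Proof.
have [n Hn] := Ca a; have [m Hm] := Ca (- a).
exists (n + m)%N => sigma s0; rewrite natrD ler_norml.
have := s0 _ Hn; rewrite rmorphB rmorph_nat.
have := s0 _ Hm; rewrite rmorphB rmorphN rmorph_nat opprK.
have := ler0n R n; have := ler0n R m.
by set x := sigma a; set u := n%:R; set v := m%:R => *; apply/andP; split; lra.
Qed.

Lemma positive_hom_pos a :
  (forall sigma, positive_hom sigma -> 0 < sigma a) -> C a.
Proof.
move=> H; have [N [N0 CN]] := kadison_dubois (R := R) Ccone H.
exact: RP_pos_unperforated CN.
Qed.

(** The only form in which approximate divisibility is used: affine functions of a single value,
    compared on positive homomorphisms. *)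
Lemma approximate_affine (g : RP P) (lambda mu e : R) : 0 < e ->
  exists g', forall sigma, positive_hom sigma ->
    `|lambda * sigma g + mu - sigma g'| <= e.
Proof.
move=> e0; pose h (tau : {ptws RP P -> R}) : R := lambda * (tau g) + mu.
have [||g' Hg'] := P_div (h := h) _ _ e0.
- have evc : continuous (fun tau : {ptws RP P -> R} => tau g).
    exact: (@proj_continuous (RP P) (fun=> R) g).
  have cc (c : R) : continuous (fun _ : {ptws RP P -> R} => c).
    exact: cst_continuous.
  apply: continuous_subspaceT => tau.
  exact: (continuousD (continuousM (cc lambda tau) (evc tau)) (cc mu tau)).
- by move=> s1 s2 t _ _ _; rewrite /h /mix; ring.
by exists g' => sigma /positive_hom_state /Hg'.
Qed.

Section AtPoint.
Variable r : 'I_d -> R.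
Hypothesis r0 : positive_point r.

Let tau : {rmorphism RP P -> R} := tau_hom P_nonneg r0.

Lemma tau_positive : positive_hom tau.
Proof. by move=> a Ca'; exact: tau_pt_ge0. Qed.

(** The multiple [N] lets one argument cover both [R_P], with [N = 1], and the rational span, where
    positivity only provides some multiple in [R_P]. *)
Lemma separating_kernel_isolated :
  (forall a' : RP P, 0 <= tau_pt r a' <= 1 -> exists (N : nat) (a : RP P),
    [/\ (0 < N)%N, C a & tau_pt r a = tau_pt r a' *+ N]) ->
  really_isolated r.
Proof.
move=> good; apply/isolated_iff => // r' r'0 I.
have J a := kernel_of_vanishing P_nonneg (a := a) r0 r'0 I.
pose tau' : {rmorphism RP P -> R} := tau_hom P_nonneg r'0.
have tau'_pos : positive_hom tau' by move=> a Ca'; exact: tau_pt_ge0.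
have [eqt|/existsNP[g neq]] := pselect (forall a, tau' a = tau a).
  apply/funext => i; pose e : {ffun 'I_d -> int} := [ffun j => (i == j)%:Z].
  have [a [b [Ha Hb E]]] := monom_quotient P_faithful e.
  have me (s : 'I_d -> R) : monom s e = s i.
    rewrite /monom (bigD1 i) //= ffunE eqxx expr1z big1 ?mulr1 // => j ji.
    by rewrite ffunE eq_sym (negPf ji) expr0z.
  have Ea (s : 'I_d -> R) : positive_point s -> tau_pt s a = s i * tau_pt s b.
    move=> s0; have sn0 j : s j != 0 by rewrite gt_eqF.
    apply: tau_pt_spec => //; rewrite -E -me; apply: specM => //; first exact: spec_monom.
    exact: spec_tau_pt.
  have := eqt a; rewrite /tau /tau' /= !Ea //.
  have -> : tau_pt r' b = tau_pt r b by exact: (eqt b).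
  by move/(mulIf (lt0r_neq0 (tau_pt_mon_gt0 P_nonneg r0 Hb))).
have neq' : tau g - tau' g != 0 by rewrite subr_eq0; apply/eqP => E; apply: neq.
(* The affine function takes the value [1/2] at [tau] and [-1] at [tau']; an error of [1/4] leaves
   the first in [[0, 1]] and the second negative. *)
pose lambda := (3 / 2) / (tau g - tau' g).
pose mu := 1 / 2 - lambda * tau g.
have e0 : 0 < 1 / 4 :> R by lra.
have [h Hh] := approximate_affine g lambda mu e0.
have h1 : 0 <= tau h <= 1.
  have := Hh _ tau_positive; rewrite (_ : lambda * _ + mu = 1 / 2); last by rewrite /mu; ring.
  rewrite ler_norml => /andP[].
  by set x := tau h => *; apply/andP; split; lra.
have h2 : tau' h < 0.
  have := Hh _ tau'_pos; rewrite ler_norml => /andP[+ _].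
  have -> : lambda * tau' g + mu = -1.
    rewrite /mu (_ : lambda * tau' g = lambda * tau g - 3 / 2); first by field.
    by rewrite /lambda; field.
  by set x := tau' h => *; lra.
have [N [a [N0 Caa E]]] := good h h1.
have : tau' (a - h *+ N) = 0.
  apply: J; rewrite -[LHS]/(tau (a - h *+ N)) rmorphB rmorphMn /=.
  by rewrite E subrr.
rewrite rmorphB rmorphMn => /eqP; rewrite subr_eq0 => /eqP E'.
have := tau'_pos _ Caa; rewrite E' pmulrn_lge0 // => h3.
by have := lt_le_trans h2 h3; rewrite ltxx.
Qed.

Hypothesis iso : really_isolated r.

Let alg := isolated_algebraic r0 iso.

Lemma tau_gen_int_root w : w \in finsupp P ->
  exists f : {poly int}, f`_0 != 0 /\ (map_poly intr f).[tau (RPgen P w)] = 0.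
Proof.
move=> wP; apply: algebraic_int_root; last first.
  by rewrite gt_eqF // tau_pt_gen_gt0.
rewrite [tau _]tau_pt_gen //.
by apply: algebraic_div; [exact: algebraic_monom|exact: algebraic_leval].
Qed.

(* A homomorphism killing [ker tau_r] sends [x^w/P] to a root of every integer
   polynomial vanishing at its algebraic value at [r], hence not to [0]: there
   are no traces of the faces of the Newton polytope to care about. *)
Lemma hom_killing_kernel (sigma : {rmorphism RP P -> R}) : positive_hom sigma ->
  (forall a, tau a = 0 -> sigma a = 0) -> forall a, sigma a = tau a.
Proof.
move=> s0 J.
have [w wP|r' r'0 Er'] := positive_hom_point P_nonneg P_faithful (sigma := sigma).
  rewrite lt_neqAle s0 ?andbT; last exact: RP_pos_gen.
  apply/eqP => sw; have [f [f0 fw]] := tau_gen_int_root wP.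
  have := J (map_poly intr f).[RPgen P w]; rewrite !horner_int_rmorph fw -sw => /(_ erefl)/eqP.
  by rewrite horner_coef0 coef_map intr_eq0 (negPf f0).
have I := vanishing_of_kernel P_nonneg P_faithful r0 r'0.
suff E : r' = r by move=> a; rewrite Er' E.
apply: (isolated_iff r0).1 => //; apply: I => a ra.
by rewrite -Er'; exact: J.
Qed.

(** The only positive homomorphism of [C + ker tau] is [tau], so Kadison-Dubois writes a multiple of
    [N1 x - 1] as [c + j]; discarding [c] leaves a lower bound in terms of [j]. *)
Lemma positive_hom_lower (x : RP P) : 0 < tau x ->
  exists (e : R) (j : RP P), [/\ 0 < e, tau j = 0 &
    forall sigma, positive_hom sigma -> e - `|sigma j| <= sigma x].
Proof.
move=> x0.
pose D := [set y : RP P | exists c j, [/\ C c, tau j = 0 & y = c + j]].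
have CsubD c : C c -> D c by move=> Cc; exists c, 0; rewrite raddf0 addr0.
have Dcone : semicone D by exact: semicone_add_kernel.
(* Large enough for [N1 x - 1] to be positive at [tau]; the subtracted [1] becomes the constant
   [e = 1 / N1]. *)
pose N1 := (Num.bound (tau x)^-1).+1.
have N1x : 1 < N1%:R * tau x.
  rewrite -ltr_pdivrMr // div1r; apply: lt_trans (archi_boundP _) _.
    by rewrite invr_ge0 ltW.
  by rewrite ltr_nat.
have [phi phi0|N [N0 [c [j [Cc j0 E]]]]] := kadison_dubois (R := R) Dcone (a := x *+ N1 - 1).
  rewrite (@hom_killing_kernel phi).
  - by rewrite rmorphB rmorph1 rmorphMn /= subr_gt0 -mulr_natl.
  - by move=> a Ca'; apply: phi0; exact: CsubD.
  - move=> a a0; apply/eqP; rewrite eq_le -[X in X && _]oppr_ge0 -rmorphN.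
    by rewrite !phi0 //; exists 0; [exists (a)|exists (- a)]; rewrite ?add0r ?rmorphN ?a0 ?oppr0; split=> //; exact: (Cn 0).
exists (N1%:R^-1), j; split=> // [|sigma s0]; first by rewrite invr_gt0.
move/(congr1 sigma): E; rewrite rmorphMn rmorphB rmorph1 rmorphMn rmorphD => E.
have := s0 _ Cc; have := ler_norm (- sigma j); rewrite normrN.
have N1r : 1 <= N%:R :> R by rewrite ler1n.
have N1r' : 1 <= N1%:R :> R by rewrite ler1n.
have j0' := normr_ge0 (sigma j).
move=> H1 H2.
rewrite -(ler_pM2r (_ : 0 < N1%:R)) ?ltr0n // mulrBl mulVf ?pnatr_eq0 // (mulr_natr (sigma x)).
have H3 : - `|sigma j| <= sigma x *+ N1 - 1.
  have [le0|gt0] := leP (sigma x *+ N1 - 1) 0; last by lra.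
  have : (sigma x *+ N1 - 1) *+ N <= sigma x *+ N1 - 1.
    by rewrite -[leRHS]mulr1n -[leLHS]mulr_natr -[leRHS]mulr_natr ler_wnM2l.
  by rewrite E => H4; lra.
have H5 : `|sigma j| <= `|sigma j| * N1%:R by rewrite ler_peMr.
by lra.
Qed.

End AtPoint.
End Main.

(** * Goodness at a really isolated point *)

(** Where [t] is small, [X >= e/2] and both terms are bounded below; elsewhere the weight [th] is so
    small that [th X >= - beta/8], while the other term is at least [beta/4]. *)
Lemma convex_lower (R : realFieldType) (X B e s t th eta K beta : R) :
  0 < e -> 0 < beta -> 0 <= s -> 0 <= th <= 1 -> s ^+ 2 <= t ->
  e - s <= X -> `|X| <= K -> beta <= B ->
  ((e / 2) ^+ 2 < t -> th <= eta) -> eta <= 1 / 2 -> eta * K <= beta / 8 ->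
  Num.min (e / 2) (beta / 8) <= th * X + (1 - th) * (B / 2).
Proof.
move=> e0 beta0 s0 /andP[th0 th1] st eX XK bB Hth eta2 etaK.
have [tle|tgt] := leP t ((e / 2) ^+ 2).
  have se : s <= e / 2.
    by have := le_trans st tle; rewrite ler_pXn2r // nnegrE; lra.
  set g := Num.min _ _.
  have g1 : g <= e / 2 by rewrite /g ge_min lexx.
  have g2 : g <= beta / 8 by rewrite /g ge_min lexx orbT.
  have -> : g = th * g + (1 - th) * g by ring.
  by apply: lerD; apply: ler_wpM2l; lra.
have the := Hth tgt.
have H1 : - (beta / 8) <= th * X.
  rewrite lerNl -mulrN; apply: le_trans etaK.
  apply: le_trans (_ : th * `|X| <= _).
    by apply: ler_wpM2l => //; rewrite -normrN ler_norm.
  by apply: ler_pM => //; exact: normr_ge0.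
have H2 : beta / 4 <= (1 - th) * (B / 2).
  have -> : beta / 4 = (1 / 2) * (beta / 2) by field.
  by apply: ler_pM; lra.
apply: le_trans (_ : beta / 8 <= _); first by rewrite ge_min lexx orbT.
by lra.
Qed.

Lemma subrXX_dvd (A : comNzRingType) (x y : A) k : exists q, x ^+ k - y ^+ k = (x - y) * q.
Proof. by eexists; exact: subrXX. Qed.

Section Good.
Variables (R : realType) (d : nat) (P : laurent d).
Hypothesis P_nonneg : nonneg_laurent P.
Hypothesis P_faithful : projectively_faithful P.
Hypothesis P_div : approximately_divisible R (@RP_pos d P) 1.
Variable r : 'I_d -> R.
Hypothesis r0 : positive_point r.
Hypothesis iso : really_isolated r.

Let C : set (RP P) := @RP_pos d P.
Let Ccone : semicone C := RP_pos_semicone P_nonneg.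
Let tau : {rmorphism RP P -> R} := tau_hom P_nonneg r0.

(* The kernel of [tau] contains [F >= 0] such that [a'] and [b - a'] are positive where
   [F] is small. Then [(1 - F/M)^k a' + (1 - (1 - F/M)^k) b/2] lies strictly between
   [0] and [b], and differs from [a'] by a multiple of [F] with rational coefficients,
   which approximate divisibility replaces by an element of the kernel. *)
Lemma isolated_interpolation (a' b : RP P) (n : nat) :
  C (b *+ n - 1) -> 0 < tau a' -> 0 < tau (b - a') ->
  exists a, [/\ C a, C (b - a) & tau a = tau a'].
Proof.
move=> Cb x10 x20.
have [e1 [j1 [e10 tj1 low1]]] := positive_hom_lower P_faithful iso x10.
have [e2 [j2 [e20 tj2 low2]]] := positive_hom_lower P_faithful iso x20.
pose e := Num.min e1 e2.
have e0 : 0 < e by rewrite lt_min e10.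
(* A sum of squares is nonnegative under every homomorphism, and it dominates both squares. *)
pose F := j1 * j1 + j2 * j2.
have [M0 HM0] := positive_hom_bound R P_nonneg F.
have [K1 HK1] := positive_hom_bound R P_nonneg a'.
have [K2 HK2] := positive_hom_bound R P_nonneg (b - a').
pose dl := (e / 2) ^+ 2.
have dl0 : 0 < dl by rewrite exprn_gt0 // divr_gt0.
pose m := (M0 + Num.bound dl).+1; pose M : R := m%:R.
have M_gt0 : 0 < M by rewrite ltr0n.
have dlM : dl < M.
  apply: lt_le_trans (archi_boundP (ltW dl0)) _.
  by rewrite ler_nat /m -addSn leq_addl.
have M0M : M0%:R <= M by rewrite ler_nat /m -addnS leq_addr.
(* A lower bound for [b], since [n b >= 1]; the successor avoids dividing by a possibly zero [n]. *)
pose beta : R := n.+1%:R^-1.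
have beta0 : 0 < beta by rewrite invr_gt0.
pose K : R := K1%:R + K2%:R.
have K0 : 0 <= K by rewrite addr_ge0.
pose eta := Num.min (1 / 2) (beta / 8 / (K + 1)).
have K10 : 0 < K + 1 by rewrite ltr_wpDl.
have eta0 : 0 < eta by rewrite lt_min !divr_gt0.
have eta2 : eta <= 1 / 2 by rewrite ge_min lexx.
have etaK : eta * K <= beta / 8.
  apply: le_trans (_ : eta * (K + 1) <= _); first by rewrite ler_pM2l // lerDl.
  by rewrite -ler_pdivlMr // ge_min lexx orbT.
have dlM1 : 0 < dl / M <= 1 by rewrite divr_gt0 // ler_pdivrMr // mul1r ltW.
have [k Hk] := bernoulli_small dlM1 eta0.
pose gam := Num.min (e / 2) (beta / 8).
have gam0 : 0 < gam by rewrite lt_min !divr_gt0.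
(* [m^k - (m - F)^k = F Q], that is, [F Q / M^k = 1 - (1 - F/M)^k]. *)
have [Q HQ] := subrXX_dvd (m%:R : RP P) (m%:R - F) k.
rewrite subKr in HQ.
have err0 : 0 < gam / (2 * M) by rewrite divr_gt0 // mulr_gt0.
(* The target is [Q (b - 2 a') / (2 M^k)], whose product with [F] turns [a'] into the convex
   combination. As [F <= M], the error costs at most [gam / 2]. *)
have [h Hh] := approximate_affine P_div (Q * (b - a' *+ 2)) (2 * M ^+ k)^-1 0 err0.
have tF : tau F = 0 by rewrite rmorphD !rmorphM tj1 tj2 !mulr0 addr0.
have key (sigma : {rmorphism RP P -> R}) : positive_hom sigma ->
    0 < sigma a' + sigma F * sigma h /\
    0 < sigma b - (sigma a' + sigma F * sigma h).
  move=> s0.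
  have t0 : sigma j1 ^+ 2 <= sigma F /\ sigma j2 ^+ 2 <= sigma F.
    by rewrite rmorphD !rmorphM -!expr2 lerDl lerDr !sqr_ge0.
  have tM0 := HM0 _ s0; have b1 := HK1 _ s0; have b2 := HK2 _ s0.
  have l1 := low1 _ s0; have l2 := low2 _ s0; have hh := Hh _ s0.
  have B1 : beta <= sigma b.
    have := s0 _ Cb; rewrite rmorphB rmorph1 rmorphMn /= subr_ge0 => H1.
    rewrite -[beta]mul1r ler_pdivrMr ?ltr0n // mulr_natr.
    apply: (le_trans H1); rewrite mulrS lerDr.
    have [n0|n0] := posnP n.
      by move: H1; rewrite n0 mulr0n => H1; have := lt_le_trans ltr01 H1; rewrite ltxx.
    by rewrite -(pmulrn_lge0 _ n0); apply: (le_trans _ H1); exact: ler01.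
  have EQ : M ^+ k - (M - sigma F) ^+ k = sigma F * sigma Q.
    by rewrite -rmorphM -HQ rmorphB !rmorphXn rmorphB rmorph_nat.
  move: hh; rewrite rmorphM rmorphB rmorphMn addr0 => hh.
  rewrite rmorphB in b2 l2.
  move: t0 tM0 b1 b2 l1 l2 hh B1 EQ.
  move: (sigma F) (sigma Q) (sigma h) (sigma a') (sigma b) (sigma j1) (sigma j2).
  move=> t q h' A B s1 s2 [t1 t2] tM0 b1 b2 l1 l2 hh B1 EQ.
  have tM : t <= M by apply: le_trans M0M; apply: le_trans tM0; exact: ler_norm.
  have tge : 0 <= t by apply: le_trans t1; exact: sqr_ge0.
  pose th := (1 - t / M) ^+ k.
  have tM1 : 0 <= t / M <= 1.
    apply/andP; split; first by apply: divr_ge0 => //; exact: ltW.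
    by rewrite ler_pdivrMr // mul1r.
  have w0 : 0 <= 1 - t / M by rewrite subr_ge0; case/andP: tM1.
  have w1 : 1 - t / M <= 1 by rewrite gerBl; case/andP: tM1.
  have th01 : 0 <= th <= 1.
    by apply/andP; split; [exact: exprn_ge0|exact: exprn_ile1].
  have the : dl < t -> th <= eta.
    move=> dt; apply: le_trans Hk; rewrite /th; apply: lerXn2r.
    - by rewrite nnegrE.
    - by rewrite nnegrE subr_ge0; case/andP: dlM1.
    - by rewrite lerB // ler_pM2r ?invr_gt0 // ltW.
  have v1 : gam <= th * A + (1 - th) * (B / 2).
    apply: (@convex_lower _ A B e `|s1| t th eta K beta) => //.
    - by rewrite real_normK ?num_real.
    - apply: le_trans l1; rewrite lerB // /e ge_min lexx //.
    - by apply: le_trans b1 _; rewrite lerDl.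
  (* Replacing [a'] by [b - a'] reflects the combination in [b/2], so the same estimate gives the
     upper bound. *)
  have v2 : gam <= th * (B - A) + (1 - th) * (B / 2).
    apply: (@convex_lower _ (B - A) B e `|s2| t th eta K beta) => //.
    - by rewrite real_normK ?num_real.
    - by apply: le_trans l2; rewrite lerB // /e ge_min lexx orbT.
    - by apply: le_trans b2 _; rewrite lerDr.
  have Mk : M ^+ k != 0 by rewrite expf_neq0 // gt_eqF.
  have thE : (M - t) ^+ k = th * M ^+ k.
    by rewrite /th -exprMn mulrBl mul1r divfK // gt_eqF.
  have E : t * ((2 * M ^+ k)^-1 * (q * (B - A *+ 2))) = (1 - th) * (B / 2 - A).
    have -> : t * ((2 * M ^+ k)^-1 * (q * (B - A *+ 2))) =
        (t * q) * ((B - A *+ 2) / (2 * M ^+ k)) by ring.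
    by rewrite -EQ thE; field.
  have hb : `|t * ((2 * M ^+ k)^-1 * (q * (B - A *+ 2))) - t * h'| <= gam / 2.
    rewrite -mulrBr normrM (ger0_norm tge).
    have -> : gam / 2 = M * (gam / (2 * M)) by field; rewrite gt_eqF.
    by apply: ler_pM.
  move: hb; rewrite E ler_norml => /andP[hb1 hb2].
  move: v1 v2 hb1 hb2 gam0; set th' := t * h'.
  have -> : (1 - th) * (B / 2 - A) = (1 - th) * (B / 2) - A + th * A by ring.
  have -> : th * (B - A) = th * B - th * A by ring.
  have -> : (1 - th) * (B / 2) = B / 2 - th * B / 2 by field.
  by clear; move=> *; split; lra.
exists (a' + F * h); split.
- apply: (positive_hom_pos (R := R) P_nonneg) => sigma /key[H _].
  by rewrite rmorphD rmorphM.
- apply: (positive_hom_pos (R := R) P_nonneg) => sigma /key[_ H].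
  by rewrite rmorphB rmorphD rmorphM.
- by rewrite rmorphD rmorphM tF mul0r addr0.
Qed.

(** Interpolation needs [tau a'] strictly inside the interval; at the endpoints [0] and [b]
    themselves serve. *)
Lemma isolated_good_at (a' b : RP P) (n : nat) :
  C (b *+ n - 1) -> 0 <= tau a' <= tau b ->
  exists a, [/\ C a, C (b - a) & tau a = tau a'].
Proof.
move=> Cb /andP[a0 ab].
have Cb' : C b.
  have [n0|n0] := posnP n; last first.
    apply: (RP_pos_unperforated P_nonneg n0).
    by rewrite -[b *+ n](subrK 1); apply: (semicone_add Ccone) => //; exact: (semicone_nat Ccone 1).
  have := tau_pt_ge0 P_nonneg r0 Cb; rewrite -[tau_pt r _]/(tau _) n0 mulr0n sub0r.
  by rewrite rmorphN rmorph1 oppr_ge0 ler10.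
have C0 : C 0 by exact: (semicone_nat Ccone 0).
have [E|a0'] := eqVneq (tau a') 0; first by exists 0; rewrite subr0 E raddf0.
have [E|ab'] := eqVneq (tau a') (tau b); first by exists b; rewrite subrr E.
apply: (isolated_interpolation Cb); first by rewrite lt_neqAle eq_sym a0'.
by rewrite rmorphB subr_gt0 lt_neqAle ab'.
Qed.

(* [T] is [{1}] for [R_P] and the set of all positive integers for [R_P (x) Q]. *)
Lemma isolated_good_scaled (T : set nat) :
  T 1%N -> (forall m n, T m -> T n -> T (m * n)%N) -> (forall n, T n -> (0 < n)%N) ->
  (forall w, w \in finsupp P -> exists (D : nat) (z : RP P), T D /\ tau (RPgen P w * z) = D%:R) ->
  forall b, C b -> forall a', 0 <= tau a' <= tau b ->
  exists (N : nat) (a : RP P), [/\ T N, C a, C (b *+ N - a) & tau a = tau a' *+ N].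
Proof.
move=> T1 TM T0 Hgen.
have Hmon y : RPmon y -> exists (D : nat) (z : RP P), T D /\ tau (y * z) = D%:R.
  elim=> [|w y' wP _ [D' [z' [TD' E']]]]; first by exists 1%N, 1; rewrite mulr1 rmorph1.
  have [D [z [TD E]]] := Hgen w wP; exists (D * D')%N, (z * z'); split; first exact: TM.
  by rewrite mulrACA rmorphM E E' natrM.
have Cmn c k : C c -> C (c *+ k) by exact: semicone_natmul.
apply: (RP_pos_ind P_nonneg) => [a'|b1 b2 Cb1 Cb2 H1 H2 a' /andP[a0 ab]|y Hy a' /andP[a0 ab]].
- rewrite raddf0 -eq_le => /eqP E; exists 1%N, 0; split=> //.
  + exact: (semicone_nat Ccone 0).
  + by rewrite mul0rn subrr; exact: (semicone_nat Ccone 0).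
  + by rewrite raddf0 -E.
(* Either [a'] already fits below [b1], or [b1] is used up entirely and the rest is taken below
   [b2]. *)
- have [le1|gt1] := leP (tau a') (tau b1).
    have [|N [a [TN Ca Cba E]]] := H1 a'; first by rewrite a0.
    exists N, a; split=> //; rewrite mulrnDl addrAC.
    by apply: (semicone_add Ccone) => //; exact: Cmn.
  have [|N [a [TN Ca Cba E]]] := H2 (a' - b1).
    by rewrite rmorphB subr_ge0 ltW //= lerBlDl; move: ab; rewrite rmorphD.
  exists N, (a + b1 *+ N); split=> //.
  + by apply: (semicone_add Ccone) => //; exact: Cmn.
  + by rewrite mulrnDl (addrC a) opprD addrACA subrr add0r.
  + by rewrite rmorphD E rmorphB mulrnBl rmorphMn subrK.
have [D [z [TD Ez]]] := Hmon y Hy.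
have y0 : 0 < tau y by exact: tau_pt_mon_gt0.
have tz : tau z = D%:R / tau y by rewrite -Ez rmorphM mulrC mulKf // gt_eqF.
have D0 : 0 < D%:R :> R by rewrite ltr0n T0.
(* [z] acts as [D / y] at [r]: goodness at the order unit [D] is applied to [a' z], and multiplying
   the result by [y] returns to the interval below [D y]. *)
have [||a [Ca CDa Ea]] := @isolated_good_at (a' * z) D%:R 1.
- by rewrite mulr1n -(prednK (T0 _ TD)) -natr1 addrK; exact: (semicone_nat Ccone).
- have q0 : 0 <= tau a' / tau y by apply: divr_ge0 => //; exact: ltW.
  have q1 : tau a' / tau y <= 1 by rewrite ler_pdivrMr // mul1r.
  have -> : tau (a' * z) = D%:R * (tau a' / tau y) by rewrite rmorphM tz mulrCA.
  by rewrite rmorph_nat mulr_ge0 ?(ltW D0) //= ler_piMr // ltW.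
- exists D, (y * a); split=> //.
  + by apply: (semicone_mul Ccone) => //; exact: RP_pos_mon.
  + by rewrite -mulr_natr -mulrBr; apply: (semicone_mul Ccone) => //; exact: RP_pos_mon.
  + by rewrite !rmorphM Ea rmorphM tz -mulr_natr; field; rewrite gt_eqF.
Qed.

End Good.

(** * The rational span *)

Section RationalSpan.
Variables (d : nat) (P : laurent d).
Hypothesis P_nonneg : nonneg_laurent P.

Lemma ratfun_natmul_inj n : (0 < n)%N -> injective (fun f : ratfun d => f *+ n).
Proof.
move=> n0 f g; rewrite -(mulr_natr f) -(mulr_natr g); apply: mulIf.
rewrite -[_%:R](rmorph_nat (@tofrac _)) /= tofrac_eq0.
apply/eqP => /(congr1 (mmap intr (fun=> 1 : rat))).
by rewrite rmorph_nat raddf0 => /eqP; rewrite pnatr_eq0 gtn_eqF.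
Qed.

Lemma ratr_ratfun q : (ratr q : ratfun d) *+ absz (denq q) = (numq q)%:~R.
Proof.
rewrite /ratr -mulr_natr -mulrA.
have -> : (denq q)%:~R = (absz (denq q))%:R :> ratfun d.
  by rewrite -[denq q in LHS]absz_denq pmulrn.
rewrite mulVf ?mulr1 //; apply/eqP => E.
have n0 : (0 < absz (denq q))%N by rewrite absz_gt0 denq_neq0.
have /eqP : (1 : ratfun d) = 0 by apply: (ratfun_natmul_inj n0); rewrite mul0rn; exact: E.
by rewrite oner_eq0.
Qed.

Lemma ratr_invn n : (0 < n)%N -> (ratr (n%:R^-1 : rat) : ratfun d) *+ n = 1.
Proof.
move=> n0; set q : rat := n%:R^-1.
have dq : (0 < absz (denq q))%N by rewrite absz_gt0 denq_neq0.
apply: (ratfun_natmul_inj dq); rewrite -mulrnA mulnC mulrnA ratr_ratfun.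
have E : numq q * n%:Z = denq q.
  have n0' : n%:R != 0 :> rat by rewrite pnatr_eq0 -lt0n.
  have : (numq q)%:~R * n%:R = (denq q)%:~R :> rat.
    have := divq_num_den q; rewrite {3}/q => Eq.
    have dq' : (denq q)%:~R != 0 :> rat by rewrite intr_eq0 denq_neq0.
    by rewrite -[(numq q)%:~R](divfK dq') Eq mulrAC mulVf ?mul1r.
  by rewrite -[n%:R]/(n%:Z%:~R) -intrM => /intr_inj.
rewrite -[LHS]mulr_natr -[n%:R]/(n%:Z%:~R) -intrM E.
by rewrite -[denq q in LHS]absz_denq pmulrn.
Qed.

Lemma RPQ_valB (f g : RPQ P) : RPQ_val (f - g) = RPQ_val f - RPQ_val g.
Proof. by rewrite [LHS](raddfB (val : RPQ P -> _)). Qed.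

Lemma RPQ_valD (f g : RPQ P) : RPQ_val (f + g) = RPQ_val f + RPQ_val g.
Proof. by rewrite [LHS](raddfD (val : RPQ P -> _)). Qed.

Lemma RPQ_rep (f : RPQ P) : exists (N : nat) (h : RP P),
  (0 < N)%N /\ RPQ_val f *+ N = RP_val h.
Proof.
have := RPQ_valP f; rewrite inE; move: (RPQ_val f); apply: rat_span_ind.
- by exists 1%N, 0; rewrite RP_val0 mul0rn.
- move=> x y [N [h [N0 Ex]]] [M [k [M0 Ey]]].
  exists (N * M)%N, (h *+ M - k *+ N); split; first by rewrite muln_gt0 N0.
  by rewrite RP_valB !RP_val_natmul -Ex -Ey mulrnBl -!mulrnA (mulnC M).
- move=> q x [N [h [N0 Ex]]].
  exists (absz (denq q) * N)%N, (h *~ numq q); split.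
    by rewrite muln_gt0 N0 absz_gt0 denq_neq0.
  by rewrite RP_val_mulrz -Ex mulrnA -mulrnAl ratr_ratfun -mulrnAr mulrzl.
- move=> x xP; exists 1%N, (MkRP xP); split => //.
Qed.

Lemma RPQ_pos_rep (f : RPQ P) : RPQ_pos f -> exists (N : nat) (h : RP P),
  [/\ (0 < N)%N, RP_pos h & RPQ_val f *+ N = RP_val h].
Proof.
have Cn := semicone_nat (RP_pos_semicone P_nonneg).
have CD := semicone_add (RP_pos_semicone P_nonneg).
have Cmn (c : RP P) k : RP_pos c -> RP_pos (c *+ k).
  exact: semicone_natmul (RP_pos_semicone P_nonneg).
rewrite /RPQ_pos /=; move: (RPQ_val f); apply: nonneg_rat_span_ind.
- by exists 1%N, 0; split; [|exact: (Cn 0)|rewrite RP_val0 mul0rn].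
- move=> x y [N [h [N0 Ch Ex]]] [M [k [M0 Ck Ey]]].
  exists (N * M)%N, (h *+ M + k *+ N); split; first by rewrite muln_gt0 N0.
    by apply: CD; exact: Cmn.
  by rewrite RP_valD !RP_val_natmul -Ex -Ey mulrnDl -!mulrnA (mulnC M).
- move=> q x q0 [N [h [N0 Ch Ex]]].
  exists (absz (denq q) * N)%N, (h *+ absz (numq q)); split.
  + by rewrite muln_gt0 N0 absz_gt0 denq_neq0.
  + exact: Cmn.
  rewrite RP_val_natmul -Ex mulrnA -mulrnAl ratr_ratfun -mulrnAr mulrzl.
  by rewrite -[numq q in LHS]gez0_abs ?numq_ge0 // pmulrn.
- by move=> _ [h Ch <-]; exists 1%N, h.
Qed.

Lemma RPQ_div (h : RP P) N : (0 < N)%N -> exists f : RPQ P, RPQ_val f *+ N = RP_val h.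
Proof.
move=> N0.
have H : ratr (N%:R^-1 : rat) * RP_val h \in RPQ_pred P.
  by rewrite inE; apply: rat_span_gen; exact: RP_valP.
by exists (MkRPQ H); rewrite /= -mulrnAl ratr_invn // mul1r.
Qed.

Lemma RPQ_pos_of (f : RPQ P) (h : RP P) N : (0 < N)%N -> RP_pos h ->
  RPQ_val f *+ N = RP_val h -> RPQ_pos f.
Proof.
move=> N0 Ch E.
have Ef : RPQ_val f = ratr (N%:R^-1 : rat) * RP_val h.
  by apply: (ratfun_natmul_inj N0); rewrite -mulrnAl ratr_invn // mul1r.
rewrite /RPQ_pos /= Ef; apply: nonneg_rat_span_gen; last by exists h.
by rewrite invr_ge0 ler0n.
Qed.

Variables (R : realType) (r : 'I_d -> R).
Hypothesis r0 : positive_point r.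

Let tau : {rmorphism RP P -> R} := tau_hom P_nonneg r0.

Lemma tau_ptQ_rep (f : RPQ P) (h : RP P) N : (0 < N)%N ->
  RPQ_val f *+ N = RP_val h -> tau_ptQ r f = tau_pt r h / N%:R.
Proof.
move=> N0 E; have N0' : N%:R != 0 :> R by rewrite pnatr_eq0 -lt0n.
rewrite /tau_ptQ; case: xgetP => [t -> [q [h' [Ef ->]]]|]; last first.
  move=> /(_ (ratr (N%:R^-1) * tau_pt r h)) []; exists N%:R^-1, h; split=> //.
  by apply: (ratfun_natmul_inj N0); rewrite -mulrnAl ratr_invn // mul1r.
have Eh : h *+ absz (denq q) = h' *~ numq q *+ N.
  apply: RP_val_inj; rewrite !RP_val_natmul -E Ef RP_val_mulrz.
  by rewrite -mulrnA mulnC mulrnA -mulrnAl ratr_ratfun mulrzl.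
move/(congr1 tau): Eh; rewrite !rmorphMn rmorphMz /= => Eh.
have dq : (denq q)%:~R != 0 :> R by rewrite intr_eq0 denq_neq0.
apply/eqP; rewrite /ratr mulrAC eqr_div //; apply/eqP.
rewrite mulrzl mulr_natr -Eh -[denq q in RHS]absz_denq -mulr_natr.
by rewrite pmulrn.
Qed.

Lemma tau_ptQ_trace : is_trace (@RPQ_pos d P) (tau_ptQ r).
Proof.
split.
- move=> f g; have [N [h [N0 Ef]]] := RPQ_rep f; have [M [k [M0 Eg]]] := RPQ_rep g.
  have E : RPQ_val (f + g) *+ (N * M) = RP_val (h *+ M + k *+ N).
    by rewrite RPQ_valD RP_valD !RP_val_natmul -Ef -Eg mulrnDl -!mulrnA (mulnC M).
  rewrite (tau_ptQ_rep _ E) ?muln_gt0 ?N0 // (tau_ptQ_rep N0 Ef) (tau_ptQ_rep M0 Eg).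
  rewrite -[tau_pt r (_ + _)]/(tau (_ + _)) rmorphD !rmorphMn /= natrM.
  rewrite -(mulr_natr (tau_pt r h)) -(mulr_natr (tau_pt r k)).
  by field; rewrite !pnatr_eq0 -!lt0n N0 M0.
- move=> f /RPQ_pos_rep[N [h [N0 Ch Ef]]].
  by rewrite (tau_ptQ_rep N0 Ef) divr_ge0 // tau_pt_ge0.
- have [f Ef] := @RPQ_div 1 1 isT; exists f; rewrite (tau_ptQ_rep _ Ef) //.
  by rewrite -[tau_pt r 1]/(tau 1) rmorph1 divr1 oner_neq0.
Qed.

Hypothesis P_faithful : projectively_faithful P.
Hypothesis P_div : approximately_divisible R (@RP_pos d P) 1.

Lemma good_rational_isolated : good_trace (@RPQ_pos d P) (tau_ptQ r) -> really_isolated r.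
Proof.
move=> [_ good]; apply: (separating_kernel_isolated P_nonneg P_faithful P_div r0).
move=> a' a'01.
have [b Eb] := @RPQ_div 1 1 isT; have [f Ef] := @RPQ_div a' 1 isT.
have Cb : RPQ_pos b.
  by apply: RPQ_pos_of Eb => //; exact: (semicone_nat (RP_pos_semicone P_nonneg) 1).
have tb : tau_ptQ r b = 1.
  by rewrite (tau_ptQ_rep _ Eb) // -[tau_pt r 1]/(tau 1) rmorph1 divr1.
have tf : tau_ptQ r f = tau_pt r a' by rewrite (tau_ptQ_rep _ Ef) // divr1.
have [|g [Cg _ Eg]] := good b Cb f; first by rewrite tb tf.
move: Cg; rewrite /cle subr0 => /RPQ_pos_rep[N [h [N0 Ch Eh]]].
exists N, h; split=> //; move: Eg; rewrite tf (tau_ptQ_rep N0 Eh) => <-.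
by rewrite -(mulr_natr (_ / _)) divfK // pnatr_eq0 -lt0n.
Qed.

Lemma isolated_good_rational : really_isolated r -> good_trace (@RPQ_pos d P) (tau_ptQ r).
Proof.
move=> iso; split; first exact: tau_ptQ_trace.
move=> b /RPQ_pos_rep[M [h [M0 Ch Eb]]] a' a'b.
have [N [k [N0 Ea]]] := RPQ_rep a'.
have MN0 : (0 < M * N)%N by rewrite muln_gt0 M0.
have Eb' : RPQ_val b *+ (M * N) = RP_val (h *+ N) by rewrite RP_val_natmul -Eb mulrnA.
have Ea' : RPQ_val a' *+ (M * N) = RP_val (k *+ M).
  by rewrite RP_val_natmul -Ea mulnC mulrnA.
have Ch' : RP_pos (h *+ N).
  exact: semicone_natmul (RP_pos_semicone P_nonneg) Ch.
have [|||||L [a [L0 Ca Cba Eta]]] := @isolated_good_scaled R d P P_nonneg P_faithful P_div r r0 iso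
  [set n | (0 < n)%N] _ _ _ _ (h *+ N) Ch' (k *+ M).
- by [].
- by move=> m n /= m0 n0; rewrite muln_gt0 m0.
- by [].
(* Writing [f = g X + c] with [c] nonzero, the relation at [t = tau (x^w/P)] reads [g(t) t = - c];
   up to sign, [g] evaluated at [x^w/P] is the required [z], with [D = |c|]. *)
- move=> w wP; have [f] := tau_gen_int_root P_nonneg r0 iso wP.
  elim/poly_ind: f => [|g c _]; first by rewrite coef0 eqxx; case.
  rewrite coefD coefMX coefC /= add0r => -[c0].
  rewrite rmorphD rmorphM /= map_polyX map_polyC hornerD hornerMX hornerC => gw.
  exists (absz c), ((map_poly intr g).[RPgen P w] *~ (- sgz c)); split.
    by rewrite /= absz_gt0.
  rewrite -[LHS]/(tau _) (rmorphM tau) (rmorphMz tau) (horner_int_rmorph tau) mulrzAr mulrC.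
  have -> : (map_poly intr g).[tau (RPgen P w)] * tau (RPgen P w) = - c%:~R.
    by apply/eqP; rewrite -addr_eq0; apply/eqP.
  by rewrite mulNrz mulrNz opprK -mulrzA mulrC -abszEsg -pmulrn.
- move: a'b; rewrite (tau_ptQ_rep MN0 Eb') (tau_ptQ_rep MN0 Ea').
  by rewrite ler_pM2r ?invr_gt0 ?ltr0n // pmulr_lge0 // invr_gt0 ltr0n.
have LMN0 : (0 < M * N * L)%N by rewrite muln_gt0 MN0.
have [f Ef] := @RPQ_div a _ LMN0.
exists f; split.
- by rewrite /cle subr0; apply: RPQ_pos_of Ef.
- apply: (RPQ_pos_of LMN0 Cba).
  by rewrite RPQ_valB RP_valB mulrnBl Ef RP_val_natmul -Eb' mulrnA.
- rewrite (tau_ptQ_rep LMN0 Ef) (tau_ptQ_rep MN0 Ea') -[tau_pt r a]/(tau a) Eta.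
  rewrite [in LHS]natrM -mulr_natr invfM mulrACA divff ?mulr1 //.
  by rewrite pnatr_eq0 -lt0n.
Qed.

End RationalSpan.

(** * Pure traces *)

Section PureTraces.
Variables (R : realType) (d : nat) (P : laurent d).
Hypothesis P_nonneg : nonneg_laurent P.

Let C : set (RP P) := @RP_pos d P.
Let Ccone : semicone C := RP_pos_semicone P_nonneg.

Section Pure.
Variable tau : RP P -> R.
Hypothesis pure : pure_trace C 1 tau.
Hypothesis faithful : faithful_trace C tau.

Let tauD : {morph tau : g h / g + h}. Proof. by case: pure => -[[]]. Qed.
Let tau_ge0 g : C g -> 0 <= tau g. Proof. by case: pure => -[[_ + _]] _ _; apply. Qed.
Let tau1 : tau 1 = 1. Proof. by case: pure => -[]. Qed.

Let tauB : zmod_morphism tau.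
Proof. by move=> a b; apply/eqP; rewrite eq_sym subr_eq -tauD subrK. Qed.

Let tau0 : tau 0 = 0. Proof. by rewrite -(subrr 0) tauB subrr. Qed.

Let tau_nat n : tau n%:R = n%:R.
Proof. by elim: n => [|n IH]; [exact: tau0|rewrite -!natr1 tauD IH tau1]. Qed.

(* For [0 <= a <= n], [tau] is the convex combination of the normalizations of
   [g |-> tau (a g)] and [g |-> tau ((n - a) g)]. *)
Lemma pure_trace_mulC a g : C a -> tau (a * g) = tau a * tau g.
Proof.
move=> Ca; have [ta0|ta0] := eqVneq (tau a) 0.
  by have -> : a = 0 by [apply: (faithful.2)]; rewrite !mul0r tau0 mul0r.
have ta : 0 < tau a by rewrite lt_neqAle eq_sym ta0 tau_ge0.
have [m Cm] := semicone_arch Ccone a.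
(* One more than the archimedean bound, so that [n - a] has strictly positive trace and can be
   normalized. *)
pose n := m.+1.
have Cna : C (n%:R - a).
  by rewrite /n -natr1 addrAC; apply: (semicone_add Ccone) => //; exact: (semicone_nat Ccone 1).
have tan : tau a < n%:R.
  by have := tau_ge0 Cm; rewrite tauB tau_nat subr_ge0 => H; apply: le_lt_trans H _; rewrite ltr_nat.
have tna : 0 < tau (n%:R - a) by rewrite tauB tau_nat subr_gt0.
have st c : C c -> 0 < tau c -> states C 1 (fun g => tau (c * g) / tau c).
  move=> Cc tc; split; last by rewrite mulr1 divff // gt_eqF.
  split.
  - by move=> u v; rewrite mulrDr tauD mulrDl.
  - move=> u Cu; apply: divr_ge0; last exact: ltW.
    by apply: tau_ge0; exact: (semicone_mul Ccone).
  - by exists 1; rewrite mulr1 divff ?oner_neq0 // gt_eqF.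
have n0 : 0 < n%:R :> R by rewrite ltr0n.
have [||E _] := pure.2 _ _ (tau a / n%:R) (st _ Ca ta) (st _ Cna tna).
- by rewrite divr_gt0 //= ltr_pdivrMr // mul1r.
- apply/funext => u; rewrite /mix.
  have tauM k : tau (k%:R * u) = k%:R * tau u.
    rewrite !mulr_natl; elim: k => [|k IH]; first exact: tau0.
    by rewrite !mulrS tauD IH.
  rewrite (mulrBl u n%:R a) !tauB tauM tau_nat.
  by field; rewrite !gt_eqF // subr_gt0.
by have /= <- := congr1 (fun f => f g) E; rewrite [RHS]mulrC divfK.
Qed.

(** Purity gives multiplicativity on the cone, hence everywhere; faithfulness keeps every [x^w/P]
    away from [0]. *)
Lemma pure_faithful_point : projectively_faithful P ->
  exists2 r : 'I_d -> R, positive_point r & tau = tau_pt r.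
Proof.
move=> P_faithful.
have tauM : monoid_morphism tau.
  split => // a b; have [n Cn] := semicone_arch Ccone a.
  have -> : a = n%:R - (n%:R - a) by rewrite subKr.
  rewrite mulrBl !tauB !pure_trace_mulC //; last exact: (semicone_nat Ccone).
  by rewrite !tauB; ring.
pose sigma : {rmorphism RP P -> R} := HB.pack tau
  (GRing.isZmodMorphism.Build _ _ tau tauB) (GRing.isMonoidMorphism.Build _ _ tau tauM).
have [w wP|r r0 E] := positive_hom_point P_nonneg P_faithful (sigma := sigma).
  rewrite lt_neqAle tau_ge0 ?andbT; last exact: RP_pos_gen.
  rewrite eq_sym; apply/eqP => /(faithful.2 _ (RP_pos_gen P_nonneg wP)).
  exact: RPmon_neq0 (RPmon_gen wP).
by exists r => //; apply/funext.
Qed.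

End Pure.

Lemma tau_pt_trace (r : 'I_d -> R) : positive_point r -> is_trace C (tau_pt r).
Proof.
move=> r0; have := positive_hom_state (tau_positive P_nonneg r0).
by case.
Qed.

Hypothesis P_faithful : projectively_faithful P.
Hypothesis P_div : approximately_divisible R (@RP_pos d P) 1.

Lemma good_at_one_isolated (r : 'I_d -> R) : positive_point r ->
  good_at C (tau_pt r) 1 -> really_isolated r.
Proof.
move=> r0 good; apply: (separating_kernel_isolated P_nonneg P_faithful P_div r0).
move=> a' a'01; have [|a [Ca _ E]] := good a'.
  by rewrite -[tau_pt r 1]/(tau_hom P_nonneg r0 1) rmorph1.
by exists 1%N, a; split=> //; move: Ca; rewrite /cle subr0.
Qed.

(* An element of the interval [0, x^v/P] is [x^v/P] times an element of [R_P], so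
   goodness makes [r^v/P(r)] divide all small values, which generate all values. *)
Lemma good_gen_invertible (r : 'I_d -> R) v : positive_point r -> v \in finsupp P ->
  good_at C (tau_pt r) (RPgen P v) -> exists z : RP P, tau_pt r (RPgen P v * z) = 1.
Proof.
move=> r0 vP good; pose tau : {rmorphism RP P -> R} := tau_hom P_nonneg r0.
set y := RPgen P v; have y0 : 0 < tau y by exact: tau_pt_gen_gt0.
have small a' : 0 <= tau a' <= tau y -> exists z, tau a' = tau (y * z).
  move=> /good[a [Ca Cya E]]; have [|z Ez] := RP_interval_gen P_nonneg vP _ Cya.
    by move: Ca; rewrite /cle subr0.
  by exists z; rewrite -Ez; exact: esym E.
have e0 : 0 < tau y / 4 by rewrite divr_gt0.
(* The constant function [tau y / 2] within [tau y / 4]: any [g] with value strictly positive and at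
   most [tau y] will do. *)
have [g Hg] := approximate_affine P_div 0 0 (tau y / 2) e0.
have := Hg _ (tau_positive P_nonneg r0); rewrite mul0r add0r ler_norml -/tau => /andP[g1 g2].
have g0 : 0 < tau g by move: g1 g2 y0; clear; move: (tau y) (tau g) => *; lra.
have gy : tau g <= tau y by move: g1 g2 y0; clear; move: (tau y) (tau g) => *; lra.
have [|z1 E1] := small g; first by rewrite (ltW g0).
(* Division of [1] by [tau g]: the remainder [1 - q g] has its value in [[0, tau g)], so both [g]
   and the remainder are small. *)
pose q := Num.truncn (tau g)^-1.
have /andP[q1 q2] : q%:R <= (tau g)^-1 < q.+1%:R.
  by apply: truncn_itv; rewrite invr_ge0 ltW.
have [|z2 E2] := small (1 - g *+ q).
  have -> : tau (1 - g *+ q) = 1 - q%:R * tau g.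
    by rewrite rmorphB rmorph1 rmorphMn mulr_natl.
  move: q1 q2; rewrite -[(tau g)^-1]div1r ler_pdivlMr // ltr_pdivrMr // -natr1 mulrDl mul1r.
  by move: g0 gy; clear; move: (q%:R * tau g) (tau g) (tau y) => *; apply/andP; split; lra.
exists (z1 *+ q + z2).
rewrite -[LHS]/(tau _) mulrDr (rmorphD tau) mulrnAr (rmorphMn tau) -E1 -E2.
by rewrite (rmorphB tau) rmorph1 (rmorphMn tau) addrC subrK.
Qed.

End PureTraces.

Theorem proposition4p8 (R : realType) (d : nat) (P : laurent d)
    (P_nonneg : nonneg_laurent P)
    (P_faithful : projectively_faithful P)
    (P_div : approximately_divisible R (@RP_pos d P) 1) :
  (forall tau : RP P -> R,
     pure_trace (@RP_pos d P) 1 tau -> faithful_trace (@RP_pos d P) tau ->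
     (order_unit_good_trace (@RP_pos d P) tau <->
      exists r : 'I_d -> R,
        [/\ positive_point r, really_isolated r & tau = tau_pt r])) /\
  (forall r : 'I_d -> R, positive_point r ->
     (good_trace (@RP_pos d P) (tau_pt r) <->
      really_isolated r /\
      forall v, Log P v ->
        generated_subring (ratios r P) (leval r P / monom r v))) /\
  (forall r : 'I_d -> R, positive_point r ->
     (good_trace (@RPQ_pos d P) (tau_ptQ r) <-> really_isolated r)).
Proof.
have C1 : RP_pos (1 : RP P) := semicone_nat (RP_pos_semicone P_nonneg) 1.
split; [|split].
- move=> tau pure faithful; split=> [[_ good]|[r [r0 iso ->]]].
    have [r r0 E] := pure_faithful_point P_nonneg pure faithful P_faithful.
    exists r; split=> //; rewrite E in good.
    apply: (good_at_one_isolated P_nonneg P_faithful P_div r0); apply: good.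
    split=> // g; have [m Hm] := semicone_arch (RP_pos_semicone P_nonneg) g.
    have [n Hn] := semicone_arch (RP_pos_semicone P_nonneg) (- g).
    have CD := semicone_add (RP_pos_semicone P_nonneg).
    have Cn := semicone_nat (RP_pos_semicone P_nonneg).
    exists (m + n)%N; rewrite /cle natrD opprK; split.
      have -> : g + (m%:R + n%:R) = n%:R - - g + m%:R.
        by rewrite opprK [n%:R + g]addrC -addrA (addrC n%:R).
      exact: CD Hn (Cn m).
    by rewrite addrAC; exact: CD Hm (Cn n).
  split; first exact: tau_pt_trace.
  (* An order unit dominates [1] up to a multiple, which is the hypothesis of [isolated_good_at]. *)
  move=> b [Cb /(_ 1)[n [_ Hn]]] a' a'b.
  have [a [Ca Cba E]] := isolated_good_at P_faithful P_div iso Hn a'b.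
  by exists a; split=> //; rewrite /cle subr0.
- move=> r r0; split=> [[_ good]|[iso inv]].
    split; first exact: (good_at_one_isolated P_nonneg P_faithful P_div r0 (good _ C1)).
    move=> v Pv; have vP : v \in finsupp P by rewrite mem_finsupp.
    have [z] := good_gen_invertible P_nonneg P_div r0 vP (good _ (RP_pos_gen P_nonneg vP)).
    rewrite -[tau_pt r _]/(tau_hom P_nonneg r0 _) rmorphM [tau_hom _ _ (RPgen _ _)]tau_pt_gen //.
    move=> E; apply/(subring_tau_pt P_nonneg r0); exists z.
    have l0 : leval r P != 0 by rewrite gt_eqF // leval_gt0.
    have m0 : monom r v != 0 by rewrite gt_eqF // monom_gt0.
    apply: (mulfI (_ : monom r v / leval r P != 0)); first by rewrite mulf_neq0 ?invr_eq0.
    by rewrite [LHS]E; field; rewrite l0 m0.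
  split; first exact: tau_pt_trace.
  move=> b Cb a' a'b.
  have [||||N [a [N1 Ca Cba E]]] := @isolated_good_scaled R d P P_nonneg P_faithful P_div r r0 iso
    [set 1%N] _ _ _ _ b Cb a' a'b.
  + by [].
  + by move=> m n /= -> ->.
  + by move=> n /= ->.
  + move=> w wP; have Pw : Log P w by rewrite /Log /= -mem_finsupp.
    have [z Ez] := (subring_tau_pt P_nonneg r0 _).1 (inv w Pw).
    exists 1%N, z; split => //; rewrite rmorphM [X in X * _]tau_pt_gen // [X in _ * X]Ez.
    by rewrite mulr1n; field; rewrite !gt_eqF ?leval_gt0 ?monom_gt0.
  exists a; move: Cba E; rewrite N1 !mulr1n => Cba E.
  by split=> //; rewrite /cle subr0.
- move=> r r0; split.
    exact: good_rational_isolated.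
  exact: isolated_good_rational.
Qed.
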